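(* For any $\epsilon\in(0,1]$, any finite sequence $1>\eta_1>\dots>\eta_J>0$, and any sequence $(\pi_k)_{k\ge1}$ where $\pi_k:\Omega\to\mathcal M_+^1(\Theta)$ is a $k$-partially exchangeable posterior distribution, with $\mathbb P$ probability at least $1-\epsilon$, for any $\theta\in\Theta$, $$R(\theta)\le\inf_{k\in\mathbb N^*}\Biggl\{\frac{k+1}{k}\inf_{\lambda>0}\Phi^{-1}_{\frac\lambda N}\Bigl[r_1(\theta)+\eta_J\bigl[1-r_1(\theta)\bigr]+\frac{d''_k\bigl[\theta,(\eta_j)_{j=1}^J\bigr]+\log[k(k+1)]}{\lambda}\Bigr]-\frac{r_1(\theta)}{k}\Biggr\}.$$
   Context: Setting. $N\ge1$ is an integer, $(\mathcal X,\mathcal B)$ a measurable space, $\mathcal Y$ a finite set, $\Omega=[(\mathcal X\times\mathcal Y)^N]^{\mathbb N}$ with coordinate process $(X_i,Y_i)_{i\ge1}$, and $\mathbb P=\bigl(\bigotimes_{i=1}^NP_i\bigr)^{\otimes\infty}$ where the $P_i$ are arbitrary (not necessarily identical) probability measures on $\mathcal X\times\mathcal Y$: an infinite i.i.d. sequence of samples of size $N$, only the first of which, $(X_i,Y_i)_{i=1}^N$, is observed. $(\Theta,\mathcal T)$ is a measurable space, $(\theta,x)\mapsto f_\theta(x)\in\mathcal Y$ is measurable, $\sigma$-algebras are countably generated, and $$r_1(\theta)=\frac1N\sum_{i=1}^N\mathbf 1[f_\theta(X_i)\ne Y_i],\qquad R(\theta)=\mathbb P[r_1(\theta)].$$ $\mathbb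 P'(h)=\mathbb P[h\mid(X_i,Y_i)_{i=1}^N]$. A posterior distribution (regular conditional probability measure) $\pi_k:\Omega\to\mathcal M_+^1(\Theta)$, where $\mathcal M_+^1(\Theta)$ is the set of probability measures on $\Theta$, is $k$-partially exchangeable if $\pi_k(\omega\circ s)=\pi_k(\omega)$ for every $i=1,\dots,N$ and every circular permutation $s$ of the ordered set $\{i+jN;\ j=0,\dots,k\}$ (extended by the identity to the other indices). For $k\ge1$, $\Delta_k(\theta)=\{\theta'\in\Theta:\ f_{\theta'}(X_i)=f_\theta(X_i),\ i=1,\dots,(k+1)N\}$, $d'_k(\theta)=-\mathbb P'\bigl\{\log\{\epsilon\,\pi_k[\Delta_k(\theta)]\}\bigr\}$, and $$d''_k\bigl[\theta,(\eta_j)_{j=1}^J\bigr]=d'_k(\theta)+\log(J)-\log(\eta_1)+\sum_{j=1}^{J-1}\eta_j\log\Bigl(\frac{\eta_j}{\eta_{j+1}}\Bigr)+\log\Bigl(\frac{\epsilon\eta_J}{J}\Bigr)\eta_J.$$ For $a>0$ and $q\in\mathbb R$, $\Phi_a^{-1}(q)=\frac{1-\exp(-aq)}{1-\exp(-a)}$. *)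

(* Defs.v *)
From HB Require Import structures.
From mathcomp Require Import all_boot all_order all_algebra.
From mathcomp Require Import all_classical all_reals all_analysis measurable_realfun.

Set Implicit Arguments.
Unset Strict Implicit.
Unset Printing Implicit Defensive.

Import Order.TTheory GRing.Theory Num.Theory.

Local Open Scope classical_set_scope.
Local Open Scope ring_scope.

Definition countably_generated d (T : measurableType d) : Prop :=
  exists G : nat -> set T, d.-measurable = <<s range G >>.

Definition prob_at_least d (T : measurableType d) (R : realType)
    (P : probability T R) (p : R) (A : set T) : Prop :=
  (* the inner probability of [A], which need not be measurable, is >= p *)
  exists E : set T, [/\ measurable E, (p%:E <= P E)%E & E `<=` A].

(* The space [((X * Y)^N)^nat] is flattened to sequences in [X * Y], indexed
   from 0: index [i + j * N] with [i < N] is the i-th point of the j-th sample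
   of size N, i.e. the pair (X_{i+1+jN}, Y_{i+1+jN}) in one-based notation. *)
Definition paths dX dY (X : measurableType dX) (Y : measurableType dY) : Type :=
  nat -> X * Y.

Definition cylinders dX dY (X : measurableType dX) (Y : measurableType dY)
    (D : set nat) : set (set (paths X Y)) :=
  [set A | exists n, exists B : set (X * Y),
     [/\ D n, measurable B & A = [set w : paths X Y | B (w n)]]].

Definition Omega dX dY (X : measurableType dX) (Y : measurableType dY) :=
  g_sigma_algebraType (cylinders (X := X) (Y := Y) setT).

Arguments Omega {dX dY} X Y.

Section Setting.
Context {R : realType} {dX dY dT : measure_display}.
Context {X : measurableType dX} {Y : measurableType dY}.
Context {Theta : measurableType dT}.
Variable N : nat.

Local Notation Omega := (Omega X Y).

Definition obs (w : Omega) (n : nat) : X * Y := (w : nat -> X * Y) n.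

(* [P] is the product measure [(P_1 (x) ... (x) P_N)^{(x) oo}]: it is the
   unique measure with these values on the finite-dimensional rectangles. *)
Definition is_product_law (Pi : 'I_N -> probability (X * Y)%type R)
    (P : probability Omega R) : Prop :=
  forall (A : nat -> set (X * Y)), (forall n, measurable (A n)) ->
  forall m : nat,
    P [set w | forall n, (n < m * N)%N -> A n (obs w n)] =
    (\prod_(j < m) \prod_(i < N) Pi i (A (i + j * N)%N))%E.

(* The space of [Omega] with the coarser sigma-algebra generated by the
   observed sample. *)
Definition Omega_obs :=
  g_sigma_algebraType (cylinders (X := X) (Y := Y) [set n | (n < N)%N]).

(* [Pc] is a version of the regular conditional probability under [P] given
   the first sample. *)
Definition is_regular_conditional (P : probability Omega R)
    (Pc : R.-pker Omega ~> Omega) : Prop :=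
  (forall B : set Omega, measurable B ->
     measurable_fun [set: Omega_obs] (fun w : Omega_obs => Pc w B)) /\
  (forall (A : set Omega_obs) (B : set Omega), measurable A -> measurable B ->
     (\int[P]_(w in A) Pc w B)%E = P (A `&` B)).

Definition r1 (f : Theta -> X -> Y) (theta : Theta) (w : Omega) : R :=
  N%:R^-1 * \sum_(i < N) (f theta (obs w i).1 != (obs w i).2)%:R.

Definition risk (P : probability Omega R) (f : Theta -> X -> Y)
    (theta : Theta) : \bar R :=
  ('E_P[r1 f theta])%E.

(* The r-th power of the cycle on the ordered set {i + j N; j = 0, ..., k}. *)
Definition circular_perm (k i r : nat) : nat -> nat := fun n =>
  if ((n %% N == i) && (n %/ N <= k))%N
  then (i + ((n %/ N + r) %% k.+1) * N)%N else n.

Definition partially_exchangeable (k : nat) (pik : R.-pker Omega ~> Theta)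
    : Prop :=
  forall (i r : nat), (i < N)%N ->
  forall (w : Omega) (A : set Theta), measurable A ->
    pik (fun n => obs w (circular_perm k i r n)) A = pik w A.

Definition Delta (f : Theta -> X -> Y) (k : nat) (w : Omega) (theta : Theta)
    : set Theta :=
  [set theta' | forall i, (i < k.+1 * N)%N ->
     f theta' (obs w i).1 = f theta (obs w i).1].

(* [lne 0 = -oo], so the value is [+oo] when the logarithm is not
   integrable. *)
Definition d' (f : Theta -> X -> Y) (Pc : R.-pker Omega ~> Omega) (eps : R)
    (k : nat) (pik : R.-pker Omega ~> Theta) (theta : Theta) (w : Omega)
    : \bar R :=
  (- \int[Pc w]_w' lne (eps%:E * pik w' (Delta f k w' theta)))%E.

(* Only [eta 1], ..., [eta J] matter. *)
Definition d'' (f : Theta -> X -> Y) (Pc : R.-pker Omega ~> Omega) (eps : R)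
    (J : nat) (eta : nat -> R) (k : nat) (pik : R.-pker Omega ~> Theta)
    (theta : Theta) (w : Omega) : \bar R :=
  (d' f Pc eps k pik theta w +
   (ln J%:R - ln (eta 1%N)
    + \sum_(1 <= j < J) eta j * ln (eta j / eta j.+1)
    + ln (eps * eta J / J%:R) * eta J)%:E)%E.

End Setting.

(* Extended by continuity to [q = +oo], where it is [1 / (1 - exp (- a))]. *)
Definition Phi_inv (R : realType) (a : R) (q : \bar R) : \bar R :=
  ((1 - expeR (- (a%:E * q))) * ((1 - expR (- a))^-1)%:E)%E.

(* Main.v *)
Require Import Defs.
From HB Require Import structures.
From mathcomp Require Import all_boot all_order all_algebra.
From mathcomp Require Import all_classical all_reals all_analysis measurable_realfun.
From mathcomp Require Import ring lra.

(** Fix [k] and call the error pattern of a classifier on the first sample and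
    the [k] shadow samples atypical when, for some [lambda > 0], the error rate
    [r1] on the first sample is too small for the rate [q] on all [k + 1]
    samples, relative to the posterior mass [p] of the classifiers that predict
    the same labels; with [Phi_a] the inverse of [Phi_inv a], this reads
      [lambda * Phi_(lambda / N) q - lambda * r1 > - ln (delta * p)].
    The law of the path does not change when each of the [N] columns
    [{i + j * N; j <= k}] is rotated independently, and neither do [q] and [p].
    Averaged over these rotations, [exp (- lambda * r1)] is at most
    [exp (- lambda * Phi_(lambda / N) q)]: the average factorises over the
    columns, and the product of the factors is largest when all columns have the
    same error rate ([sum_expR_shifts_le]).  Among the atypical rotations the one
    with the largest [r1] provides a single [lambda] valid for all of them, so
    that the proportion of atypical rotations is at most [delta * p]
    ([card_atypical_shifts_le]), uniformly in [lambda].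

    Summing [1 / p] over the atypical classifiers with respect to the posterior
    then yields a random variable of mean at most [delta].  It is at least 1 as
    soon as one classifier is atypical, because all those predicting the same
    labels, of total mass [p], are then atypical too.  The paths carrying an
    atypical classifier therefore lie in a measurable set of probability at most
    [delta] ([probability_exceptional_samples_le]).

    Given the first sample, the bound has to be integrated.  A regular
    conditional law almost surely leaves the first [N] observations unchanged
    and gives every later observation its own law
    ([conditional_marginals_ae]), so the conditional mean of [q] is
    [(r1 + k * R) / (k + 1)].  With [delta_j = eps * eta_j / (J * k * (k + 1))],
    Markov's inequality shows that the exceptional set of level [delta_j] has
    conditional probability at most [eta_j], except on an event of probability
    [eps / (J * k * (k + 1))]; these add up to [eps] over [j] and [k].  Outside
    them, [lambda * Phi_(lambda / N) q - lambda * r1 + ln p] is at most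
    [- ln delta_j] off the [j]-th exceptional set and at most
    [lambda * (1 - r1)] everywhere.  Integrating this staircase gives the
    [eta_j]-terms of the bound ([le_layers], [layers_monotone]), and convexity
    of [Phi] puts the conditional mean inside [Phi] ([integrated_bound]). *)

Set Implicit Arguments.
Unset Strict Implicit.
Unset Printing Implicit Defensive.

Import Order.TTheory GRing.Theory Num.Theory.
Import numFieldNormedType.Exports.

Local Open Scope classical_set_scope.
Local Open Scope ring_scope.

(** * Averaging over the cyclic shifts of an error pattern *)

(** [e] stands for the error pattern of a classifier along a path: then
    [mean N e] is its error rate on the first sample and [mean (k.+1 * N) e] its
    rate on the first [k + 1] samples. *)
Definition mean (R : realType) (n : nat) (e : nat -> bool) : R :=
  n%:R^-1 * \sum_(i < n) (e i)%:R.

(** The composite of the rotations [circular_perm N k i (s i)], [i < N], in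
    closed form. *)
Definition cyclic_shift (N k : nat) (s : nat -> nat) (n : nat) : nat :=
  if (n %/ N <= k)%N
  then (n %% N + (n %/ N + s (n %% N)) %% k.+1 * N)%N else n.

(** The group [(Z/(k+1))^N] of all simultaneous rotations, indexed by a finite
    type so that averages over it are finite sums. *)
Definition shifts (N k : nat) (s : {ffun 'I_N -> 'I_k.+1}) (i : nat) : nat :=
  oapp (fun j => s j : nat) 0%N (insub i).

(** The event [lambda * Phi_(lambda / N) (mean (k.+1 * N) e)
    - lambda * mean N e > - ln x] for some [lambda > 0], exponentiated so that
    it makes sense, and fails, at [x = 0].  Quantifying over [lambda] here is
    what makes the final bound uniform in [lambda]. *)
Definition atypical (R : realType) (N k : nat) (x : R) (e : nat -> bool) : Prop :=
  exists2 lambda : R, 0 < lambda &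
    (1 - (1 - expR (- (lambda / N%:R))) * mean R (k.+1 * N) e) ^+ N
      < x * expR (- (lambda * mean R N e)).

(** The right-hand side is the Laplace transform at [a] of a Bernoulli variable
    of mean [m], which is smallest when the variable equals 1. *)
Lemma expRN_le_laplace (R : realType) (a m : R) : 0 <= a -> m <= 1 ->
  expR (- a) <= 1 - (1 - expR (- a)) * m.
Proof.
move=> a0 m1; have E1 : expR (- a) <= 1 by rewrite -expR0 ler_expR oppr_le0.
rewrite -subr_ge0 (_ : _ - _ = (1 - expR (- a)) * (1 - m)); last by ring.
by rewrite mulr_ge0// subr_ge0.
Qed.

Section Shift.
Variables (R : realType) (N k : nat).
Hypothesis N0 : (0 < N)%N.
Implicit Types (e : nat -> bool) (s : nat -> nat).

Lemma mean_ge0 n e : 0 <= mean R n e.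
Proof. by rewrite mulr_ge0// ?invr_ge0// sumr_ge0. Qed.

Lemma mean_le1 n e : mean R n e <= 1.
Proof.
case: n => [|n]; first by rewrite /mean invr0 mul0r.
rewrite /mean mulrC ler_pdivrMr ?ltr0n// mul1r.
rewrite (le_trans (ler_sum _ (G := fun=> 1) _))//.
  by move=> i _; case: (e i).
by rewrite sumr_const card_ord.
Qed.

Lemma sum_blocks (V : nmodType) (F : nat -> V) (m : nat) :
  \sum_(n < m * N) F n = \sum_(i < N) \sum_(j < m) F (i + j * N)%N.
Proof.
elim: m => [|m IH].
  by rewrite big_ord0 big1// => i _; rewrite big_ord0.
rewrite mulSnr big_split_ord/= IH -big_split/=; apply: eq_bigr => i _.
by rewrite big_ord_recr/= addnC.
Qed.

Lemma shiftsE (sg : {ffun 'I_N -> 'I_k.+1}) (i : 'I_N) : shifts sg i = sg i.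
Proof. by rewrite /shifts insubT//= => iN; congr (nat_of_ord (sg _)); exact: val_inj. Qed.

Lemma cyclic_shift_block s i j : (i < N)%N -> (j <= k)%N ->
  cyclic_shift N k s (i + j * N) = (i + (j + s i) %% k.+1 * N)%N.
Proof.
move=> iN jk; rewrite /cyclic_shift (addnC i (j * N)%N).
by rewrite divnMDl// divn_small// addn0 jk modnMDl modn_small.
Qed.

(** A shift permutes each column [{i + j * N; j <= k}]. *)
Lemma mean_cyclic_shift e s :
  mean R (k.+1 * N) (e \o cyclic_shift N k s) = mean R (k.+1 * N) e.
Proof.
rewrite /mean; congr (_ * _).
rewrite (sum_blocks (fun n => (e (cyclic_shift N k s n))%:R)).
rewrite (sum_blocks (fun n => (e n)%:R)); apply: eq_bigr => i _.
pose h (j : 'I_k.+1) : 'I_k.+1 := inord ((j + s i) %% k.+1).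
have hE j : h j = ((j + s i) %% k.+1)%N :> nat by rewrite inordK// ltn_mod.
have h_inj : injective h.
  move=> j j' /(congr1 val); rewrite /= !hE => /eqP.
  by rewrite eqn_modDr !modn_small// => /eqP/val_inj.
rewrite [RHS](reindex_inj h_inj)/=; apply: eq_bigr => j _.
by rewrite cyclic_shift_block ?hE// -ltnS.
Qed.

Lemma mean_first_shift e (sg : {ffun 'I_N -> 'I_k.+1}) :
  mean R N (e \o cyclic_shift N k (shifts sg)) =
  N%:R^-1 * \sum_(i < N) (e (i + sg i * N)%N)%:R.
Proof.
congr (_ * _); apply: eq_bigr => i _ /=.
have := @cyclic_shift_block (shifts sg) i 0 (ltn_ord i) isT.
by rewrite mul0n addn0 shiftsE add0n => ->; rewrite modn_small.
Qed.

(** The sum over all rotations factorises into [N] sums over one column.  An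
    error being 0 or 1, [expR (- a * e) = 1 - (1 - expR (- a)) * e] is affine in
    [e], so each factor depends only on the error rate of its column, and the
    inequality between geometric and arithmetic means replaces the rates of the
    columns by their average. *)
Lemma sum_expR_shifts_le e (lambda : R) :
  \sum_(sg : {ffun 'I_N -> 'I_k.+1})
     expR (- (lambda * mean R N (e \o cyclic_shift N k (shifts sg)))) <=
  (k.+1 ^ N)%:R *
    (1 - (1 - expR (- (lambda / N%:R))) * mean R (k.+1 * N) e) ^+ N.
Proof.
set a := lambda / N%:R; set c := 1 - expR (- a).
pose F (i : 'I_N) (j : 'I_k.+1) : R := 1 - c * (e (i + j * N)%N)%:R.
have FE i j : F i j = expR (- (a * (e (i + j * N)%N)%:R)).
  rewrite /F /c; case: (e _); rewrite ?mulr1 ?mulr0 ?oppr0 ?expR0 ?subr0 ?addr0//.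
  by rewrite opprB addrC subrK.
rewrite (eq_bigr (fun sg : {ffun 'I_N -> 'I_k.+1} => \prod_i F i (sg i))); last first.
  move=> sg _; rewrite mean_first_shift mulrA -/a mulr_sumr -sumrN expR_sum.
  by apply: eq_bigr => i _; rewrite FE.
rewrite -(bigA_distr_bigA F).
pose E i := \sum_j F i j.
have E0 i : 0 <= E i by apply: sumr_ge0 => j _; rewrite FE expR_ge0.
have sumE : (\sum_i E i) / N%:R =
    k.+1%:R * (1 - c * mean R (k.+1 * N) e).
  rewrite /E /F; under eq_bigr do rewrite sumrB sumr_const card_ord -mulr_sumr.
  rewrite sumrB sumr_const card_ord -mulr_sumr.
  rewrite -(sum_blocks (fun n => (e n)%:R)) /mean natrM -[_ *+ N]mulr_natr.
  by field; rewrite nat1r !pnatr_eq0 -lt0n N0.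
have := (@leif_AGM R 'I_N predT E (fun i _ => E0 i)).1.
rewrite cardT size_enum_ord sumE => /le_trans; apply.
by rewrite natrX -exprMn.
Qed.

(** Markov's inequality for one well-chosen [lambda].  The atypical rotation
    with the largest rate on the first sample comes with a [lambda]; every other
    atypical rotation has a smaller rate, hence a larger
    [exp (- lambda * rate)], so the same [lambda] bounds their number. *)
Lemma card_atypical_shifts_le e (x : R) : 0 <= x ->
  \sum_(sg : {ffun 'I_N -> 'I_k.+1})
     `[< atypical N k x (e \o cyclic_shift N k (shifts sg)) >]%:R <=
  (k.+1 ^ N)%:R * x.
Proof.
move=> x0; pose A (sg : {ffun 'I_N -> 'I_k.+1}) :=
  `[< atypical N k x (e \o cyclic_shift N k (shifts sg)) >].
pose r (sg : {ffun 'I_N -> 'I_k.+1}) :=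
  mean R N (e \o cyclic_shift N k (shifts sg)).
have [[s0 As0]|noA] := pselect (exists sg, A sg); last first.
  rewrite big1 ?mulr_ge0// => sg _; rewrite (_ : `[< _ >] = false)//.
  by apply/negbTE/negP => ?; apply: noA; exists sg.
pose sm := [arg max_(sg > s0 | A sg) r sg]%O.
have [Asm rmax] : A sm /\ forall sg, A sg -> r sg <= r sm.
  by rewrite /sm; case: arg_maxP => // i Ai ri; split.
have /asboolP[lambda lambda0] := Asm; rewrite mean_cyclic_shift -/(r sm) => xlt.
have := sum_expR_shifts_le e lambda.
rewrite -(ler_pM2r (expR_gt0 (lambda * r sm))) => /le_trans h.
apply: (@le_trans _ _ (\sum_sg expR (- (lambda * r sg)) * expR (lambda * r sm))).
  apply: ler_sum => sg _; rewrite -/(A sg) -expRD.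
  have [/rmax rle|_] := boolP (A sg); last exact: expR_ge0.
  by rewrite -expR0 ler_expR addrC subr_ge0 ler_pM2l.
rewrite -mulr_suml; apply: h; rewrite -mulrA ler_pM2l ?ltr0n ?expn_gt0//.
rewrite -ler_pdivlMr ?expR_gt0// -expRN; exact: ltW.
Qed.

End Shift.

(** * Invariance of the product law under cyclic shifts *)

Section CyclicShift.
Variables (N k : nat).
Hypothesis N0 : (0 < N)%N.
Implicit Types s : nat -> nat.

Lemma cyclic_shift_mod s n : (cyclic_shift N k s n %% N = n %% N)%N.
Proof.
by rewrite /cyclic_shift; case: ifP => // _; rewrite addnC modnMDl modn_mod.
Qed.

Lemma cyclic_shift_div s n : (cyclic_shift N k s n %/ N =
  if n %/ N <= k then (n %/ N + s (n %% N)) %% k.+1 else n %/ N)%N.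
Proof.
rewrite /cyclic_shift; case: ifP => // _.
by rewrite addnC divnMDl// (divn_small (ltn_pmod n N0)) addn0.
Qed.

Lemma cyclic_shiftK s s' : (forall i, (s i + s' i) %% k.+1 = 0)%N ->
  cancel (cyclic_shift N k s) (cyclic_shift N k s').
Proof.
move=> ss n; rewrite {1}/cyclic_shift cyclic_shift_mod cyclic_shift_div.
have [nk|nk] := leqP (n %/ N) k; last by rewrite leqNgt nk /= /cyclic_shift leqNgt nk.
have le_k m : (m %% k.+1 <= k)%N by rewrite -ltnS ltn_mod.
rewrite le_k modnDml -addnA -modnDmr ss addn0 (@modn_small (n %/ N))//.
by rewrite addnC -divn_eq.
Qed.

Lemma ltn_cyclic_shift s m n : (k < m)%N ->
  (cyclic_shift N k s n < m * N)%N = (n < m * N)%N.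
Proof.
move=> km; rewrite -!ltn_divLR// cyclic_shift_div; case: ifP => // nk.
by rewrite (leq_ltn_trans nk km) (leq_trans _ km)// ltn_mod.
Qed.

Lemma cyclic_shift0 : cyclic_shift N k (fun=> 0%N) =1 id.
Proof.
move=> n; rewrite /cyclic_shift; case: leqP => // nk.
by rewrite addn0 (@modn_small (n %/ N))// addnC -divn_eq.
Qed.

(** Peels off one generator, so that invariance under the generators extends to
    all shifts by induction on the number of columns that move. *)
Lemma cyclic_shiftS s m :
  cyclic_shift N k (fun i => if (i < m.+1)%N then s i else 0%N) =1
  cyclic_shift N k (fun i => if (i < m)%N then s i else 0%N)
    \o circular_perm N k m (s m).
Proof.
move=> n /=; rewrite /circular_perm; have [nm|nm] /= := eqVneq (n %% N)%N m.
  have mN : (m < N)%N by rewrite -nm ltn_mod.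
  case: leqP => nk; last by rewrite /cyclic_shift leqNgt nk.
  have le_k p : (p %% k.+1 <= k)%N by rewrite -ltnS ltn_mod.
  rewrite [in LHS](divn_eq n N) addnC nm !cyclic_shift_block//.
  by rewrite ltnSn ltnn addn0 modn_mod.
by rewrite /cyclic_shift ltnS (leq_eqVlt _ m) (negbTE nm).
Qed.

End CyclicShift.

Section SampleSpace.
Context {dX dY : measure_display}.
Context {X : measurableType dX} {Y : measurableType dY}.
Local Notation Omega := (Omega X Y).

Lemma measurable_obs n : measurable_fun [set: Omega] (fun w => obs w n).
Proof.
move=> _ B mB; rewrite setTI; apply: sub_sigma_algebra.
by exists n, B; split.
Qed.

Lemma measurable_to_Omega d (T : measurableType d) (g : T -> Omega) :
  (forall n, measurable_fun setT (fun t => obs (g t) n)) ->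
  measurable_fun setT g.
Proof.
move=> mg; apply: (@measurability _ _ T Omega setT g (cylinders (X := X) (Y := Y) setT)) => //.
move=> _ [_ [n [B [_ mB ->]]] <-].
exact: (mg n measurableT B mB).
Qed.

Definition permute (s : nat -> nat) (w : Omega) : Omega := fun n => obs w (s n).

Lemma measurable_permute s : measurable_fun setT (permute s).
Proof. by apply: measurable_to_Omega => n; exact: measurable_obs. Qed.

Section ProductLaw.
Context {R : realType}.
Variables (N : nat) (N0 : (0 < N)%N) (Pi : 'I_N -> probability (X * Y)%type R).

Definition box (A : nat -> set (X * Y)) (n : nat) : set Omega :=
  [set w | forall i, (i < n)%N -> A i (obs w i)].

Lemma measurable_box A n : (forall i, measurable (A i)) -> measurable (box A n).
Proof.
move=> mA; rewrite (_ : box A n = \bigcap_(i in `I_n) ((@obs _ _ X Y)^~ i @^-1` A i)).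
  apply: bigcap_measurableType => i _; rewrite -[X in measurable X]setTI.
  exact: measurable_obs.
by apply/seteqP; split => w h i iN; exact: h.
Qed.

Lemma boxE A n m : (n <= m)%N ->
  box A n = box (fun i => if (i < n)%N then A i else setT) m.
Proof.
move=> nm; apply/seteqP; split => w /= h i im.
  by case: ifP => // /h.
by have := h i (leq_trans im nm); rewrite im.
Qed.

Lemma boxI A B n : box A n `&` box B n = box (fun i => A i `&` B i) n.
Proof.
apply/seteqP; split => [w [hA hB] i iN|w h]; first by split; [exact: hA|exact: hB].
by split=> i /h[].
Qed.

(** Boxes whose length is a multiple of [N] form a pi-system that generates the
    product sigma-algebra, and a product law is prescribed on them. *)
Lemma product_law_unique (P Q : probability Omega R) :
  is_product_law Pi P -> is_product_law Pi Q ->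
  forall A, measurable A -> P A = Q A.
Proof.
move=> hP hQ.
pose G : set (set Omega) := [set E | exists A m,
  (forall n, measurable (A n)) /\ E = box A (m * N)].
apply: (@measure_unique _ _ _ G (fun=> setT)) => //.
- apply/seteqP; split; apply: smallest_sub.
  + exact: smallest_sigma_algebra.
  + move=> _ [n [B [_ mB ->]]]; apply: sub_sigma_algebra.
    exists (fun i => if i == n then B else setT), n.+1; split.
      by move=> i; case: ifP.
    apply/seteqP; split => w /=.
      by move=> Bw i _; case: eqP => // ->.
    by move/(_ n); rewrite eqxx; apply; rewrite (@leq_trans n.+1)// leq_pmulr.
  + exact: sigma_algebra_measurable.
  + by move=> _ [A [m [mA ->]]]; exact: measurable_box.
- move=> _ _ [A [m [mA ->]]] [B [p [mB ->]]].
  rewrite (boxE A (leq_mul (leq_maxl m p) (leqnn N))).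
  rewrite (boxE B (leq_mul (leq_maxr m p) (leqnn N))) boxI.
  eexists; exists (maxn m p); split; last by reflexivity.
  by move=> n; apply: measurableI; case: ifP.
- by move=> _; exists (fun=> setT), 0%N; split => //; apply/seteqP; split.
- by apply/seteqP; split => // w _; exists 0%N.
- by move=> _ [A [m [mA ->]]]; exact: (etrans (hP A mA m) (esym (hQ A mA m))).
- by move=> i; rewrite /= probability_setT ltry.
Qed.

Variables (P : probability Omega R) (hP : is_product_law Pi P).

(** A shift moves an index inside its residue class modulo [N], and all indices
    of a class carry the same factor of the product law: the probability of a
    box only sees its factors permuted. *)
Lemma product_law_shift k s A : measurable A ->
  P (permute (cyclic_shift N k s) @^-1` A) = P A.
Proof.
move=> mA; set T := permute _.
pose mT : {mfun Omega >-> Omega} :=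
  mfun_Sub (mem_set (measurable_permute (cyclic_shift N k s))).
rewrite -[LHS]/(distribution P mT A); move: A mA.
apply: product_law_unique => // A0 mA0 m.
(* The box is lengthened so that it contains the columns that move. *)
pose M := maxn m k.+1.
pose A n := if (n < m * N)%N then A0 n else setT.
have mA n : measurable (A n) by rewrite /A; case: ifP.
have kM : (k < M)%N by rewrite leq_maxr.
have mM : (m <= M)%N by rewrite leq_maxl.
(* The inverse shift. *)
pose s' i := (k.+1 - s i %% k.+1)%N.
have ss i : ((s i + s' i) %% k.+1 = 0)%N.
  by rewrite /s' -modnDml subnKC ?modnn// ltnW// ltn_mod.
have s's i : ((s' i + s i) %% k.+1 = 0)%N by rewrite addnC.
pose B n := A (cyclic_shift N k s' n).
have prodE : (\prod_(j < m) \prod_(i < N) Pi i (A0 (i + j * N)%N) =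
    \prod_(j < M) \prod_(i < N) Pi i (A (i + j * N)%N))%E.
  have lt i j : (i < N)%N -> (i + j * N < m * N)%N = (j < m)%N.
    by move=> iN; rewrite -ltn_divLR// addnC divnMDl// divn_small// addn0.
  rewrite (big_ord_widen M (fun j => \prod_(i < N) Pi i (A0 (i + j * N)%N))%E mM).
  rewrite big_mkcond/=; apply: eq_bigr => j _; case: ifP => jm.
    by apply: eq_bigr => i _; rewrite /A lt// jm.
  by rewrite big1// => i _; rewrite /A lt// jm probability_setT.
rewrite prodE; transitivity (distribution P mT (box A0 (m * N))) => //.
rewrite (boxE A0 (leq_mul mM (leqnn N))) -/A.
have -> : distribution P mT (box A (M * N)) = P (box B (M * N)).
  rewrite /distribution /pushforward; congr (P _); apply/seteqP; split => w h n nM.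
    have := h (cyclic_shift N k s' n); rewrite ltn_cyclic_shift// => /(_ nM).
    by rewrite /= /obs /permute (cyclic_shiftK N0 s's).
  have := h (cyclic_shift N k s n); rewrite ltn_cyclic_shift// => /(_ nM).
  by rewrite /B (cyclic_shiftK N0 ss).
have -> : P (box B (M * N)) =
    (\prod_(j < M) \prod_(i < N) Pi i (B (i + j * N)%N))%E.
  by apply: hP => n; exact: mA.
rewrite [LHS]exchange_big [RHS]exchange_big/=; apply: eq_bigr => i _.
pose h (j : 'I_M) : 'I_M := insubd j (cyclic_shift N k s' (i + j * N) %/ N)%N.
have iE (j : 'I_M) : ((i + j * N) %/ N = j)%N.
  by rewrite addnC divnMDl// divn_small// addn0.
have iM (j : 'I_M) : ((i + j * N) %% N = i)%N by rewrite addnC modnMDl modn_small.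
have hE (j : 'I_M) : (i + h j * N = cyclic_shift N k s' (i + j * N))%N.
  rewrite /h val_insubd ltn_divLR// ltn_cyclic_shift// -ltn_divLR// iE ltn_ord.
  by rewrite [RHS](divn_eq _ N) cyclic_shift_mod// iM addnC.
have h_inj : injective h.
  move=> j j' /(congr1 (fun x : 'I_M => i + x * N)%N); rewrite !hE.
  move/(can_inj (cyclic_shiftK N0 s's))/(congr1 (divn^~ N)).
  by rewrite !iE => /val_inj.
by rewrite [RHS](reindex_inj h_inj)/=; apply: eq_bigr => j _; rewrite hE.
Qed.

Lemma ge0_integral_product_law_shift k s (g : Omega -> \bar R) :
  (forall w, 0 <= g w)%E -> measurable_fun setT g ->
  (\int[P]_w g (permute (cyclic_shift N k s) w) = \int[P]_w g w)%E.
Proof.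
move=> g0 mg; have mT := measurable_permute (cyclic_shift N k s).
have := @ge0_integral_pushforward _ _ _ _ R _ mT P setT g measurableT mg (fun y _ => g0 y).
rewrite preimage_setT /comp => <-.
by apply: eq_measure_integral => A mA _; exact: product_law_shift.
Qed.

End ProductLaw.

Lemma partially_exchangeable_shift (R : realType) dT (Theta : measurableType dT)
    (N k : nat) (pik : R.-pker Omega ~> Theta) (N0 : (0 < N)%N) s w A :
  partially_exchangeable N k pik -> measurable A ->
  pik (permute (cyclic_shift N k s) w) A = pik w A.
Proof.
move=> hpi mA; pose s_ m i := if (i < m)%N then s i else 0%N.
have -> : permute (cyclic_shift N k s) w = permute (cyclic_shift N k (s_ N)) w.
  apply/funext => n; rewrite /permute; congr (obs w _).
  by rewrite /cyclic_shift /s_ ltn_mod N0.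
suff H m : (m <= N)%N -> pik (permute (cyclic_shift N k (s_ m)) w) A = pik w A.
  exact: H.
elim: m => [_|m IH mN].
  by congr (pik _ A); apply/funext => n; rewrite /permute cyclic_shift0.
rewrite -(IH (ltnW mN)).
rewrite -[RHS](hpi m (s m) mN (permute (cyclic_shift N k (s_ m)) w) A mA).
congr (pik _ A); apply/funext => n; rewrite /permute; congr (obs w _).
exact: cyclic_shiftS.
Qed.

End SampleSpace.

(** * Conditional law of a single observation given the first sample *)

Section CountableGeneration.

Lemma countably_generated_finite d (T : measurableType d) :
  finite_set [set: T] -> (forall A : set T, measurable A) ->
  countably_generated T.
Proof.
move=> /finite_seqP[s sT] mT; pose g n := [set nth point s n].
exists g; apply/seteqP; split=> // A _.
rewrite (_ : A = \bigcup_(n in [set n | A (nth point s n)]) g n).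
  apply: (@bigcup_measurable _ (g_sigma_algebraType (range g))) => n _.
  by apply: sub_sigma_algebra; exists n.
apply/seteqP; split => [x Ax|x [n /= An ->]//].
have xs : x \in s by have : [set: T] x by []; rewrite sT.
by exists (index x s); rewrite /g /= nth_index.
Qed.

Lemma countably_generated_prod d1 d2 (T1 : measurableType d1)
    (T2 : measurableType d2) :
  countably_generated T1 -> countably_generated T2 ->
  countably_generated (T1 * T2)%type.
Proof.
move=> [G1 mG1] [G2 mG2].
pose G n : set (T1 * T2) := if odd n then fst @^-1` G1 n./2 else snd @^-1` G2 n./2.
have GG n : <<s range G >> (G n) by apply: sub_sigma_algebra; exists n.
pose S := g_sigma_algebraType (range G).
have m1 : measurable_fun [set: S] (fst : S -> T1).
  apply: (@measurability _ _ S T1 setT fst _ mG1) => _ [_ [n _ <-] <-].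
  by have := GG n.*2.+1; rewrite setTI /G /= odd_double uphalf_double.
have m2 : measurable_fun [set: S] (snd : S -> T2).
  apply: (@measurability _ _ S T2 setT snd _ mG2) => _ [_ [n _ <-] <-].
  by have := GG n.*2; rewrite setTI /G odd_double doubleK.
exists G; apply/seteqP; split.
  rewrite measurable_prod_measurableType; apply: smallest_sub.
    exact: smallest_sigma_algebra.
  move=> _ [A mA] [B mB] <-.
  rewrite (_ : A `*` B = (fst : S -> T1) @^-1` A `&` (snd : S -> T2) @^-1` B)//.
  apply: (@measurableI _ S).
    by rewrite -[X in measurable X]setTI; exact: m1.
  by rewrite -[X in measurable X]setTI; exact: m2.
apply: smallest_sub; first exact: sigma_algebra_measurable.
move=> _ [n _ <-]; rewrite /G; case: ifP => _; rewrite -[X in measurable X]setTI.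
  apply: (@measurable_fst _ _ T1 T2 measurableT); rewrite mG1.
  by apply: sub_sigma_algebra; exists n./2.
apply: (@measurable_snd _ _ T1 T2 measurableT); rewrite mG2.
by apply: sub_sigma_algebra; exists n./2.
Qed.

(** Finite intersections of countably many generators form a countable
    pi-system.  Almost sure equality of two random measures thereby reduces to
    countably many almost sure equalities of random variables. *)
Lemma countable_determining_class d (T : measurableType d) (R : realType) :
  countably_generated T ->
  exists C : seq nat -> set T, (forall s, measurable (C s)) /\
    forall m1 m2 : {measure set T -> \bar R}, (m1 setT < +oo)%E ->
      (forall s, m1 (C s) = m2 (C s)) -> forall A, measurable A -> m1 A = m2 A.
Proof.
move=> [G mG]; pose C (s : seq nat) := \bigcap_(i in [set` s]) G i.
have GG n : measurable (G n) by rewrite mG; apply: sub_sigma_algebra; exists n.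
have mC s : measurable (C s) by apply: bigcap_measurableType => i _; exact: GG.
have C0 : C [::] = setT by rewrite /C set_nil bigcap_set0.
exists C; split => // m1 m2 m1oo m12.
apply: (@measure_unique _ _ _ (range C) (fun=> setT)) => //.
- rewrite mG; apply/seteqP; split; apply: smallest_sub;
    try exact: smallest_sigma_algebra.
    move=> _ [n _ <-]; apply: sub_sigma_algebra; exists [:: n] => //.
    rewrite /C (_ : [set` [:: n]] = [set n]) ?bigcap_set1//.
    by apply/seteqP; split => x /=; rewrite inE => /eqP.
  by move=> _ [s _ <-]; have := mC s; rewrite mG.
- move=> _ _ [s _ <-] [t _ <-]; exists (s ++ t) => //.
  rewrite /C -bigcap_setU; congr (bigcap _ G); apply/seteqP.
  split=> x /=; rewrite mem_cat; first by move/orP.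
  by move=> ?; apply/orP.
- by move=> _; exists [::].
- by apply/seteqP; split => // x _; exists 0%N.
- by move=> _ [s _ <-].
Qed.

End CountableGeneration.

Section Conditional.
Context {R : realType} {dX dY : measure_display}.
Context {X : measurableType dX} {Y : measurableType dY}.
Local Notation Omega := (Omega X Y).
Variables (N : nat) (N0 : (0 < N)%N) (Pi : 'I_N -> probability (X * Y)%type R).
Variables (P : probability Omega R) (hP : is_product_law Pi P).
Variables (P' : R.-pker Omega ~> Omega) (hP' : is_regular_conditional N P P').
Local Notation Omega_obs := (@Omega_obs _ _ X Y N).

Lemma measurable_Omega_obs (A : set Omega_obs) : measurable A -> measurable (A : set Omega).
Proof.
move: A; apply: smallest_sub.
  exact: (@sigma_algebra_measurable _ Omega).
move=> _ [n [B [nN mB ->]]]; apply: sub_sigma_algebra.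
by exists n, B.
Qed.

Lemma measurable_id_obs : measurable_fun setT (id : Omega -> Omega_obs).
Proof. by move=> _ A mA; rewrite setTI; exact: measurable_Omega_obs. Qed.

(** Conditional probabilities are determined almost everywhere only by their
    integrals over observable events, so they are compared under the image of
    [P] on the observable sigma-algebra. *)
Let id_obs : {mfun Omega >-> Omega_obs} := mfun_Sub (mem_set measurable_id_obs).
Let P_obs : probability Omega_obs R := distribution P id_obs.

Lemma regular_conditional_ae (B : set Omega) (h : Omega_obs -> \bar R) :
  measurable B -> measurable_fun setT h -> (forall w, 0 <= h w <= 1)%E ->
  (forall A : set Omega_obs, measurable A ->
     P (A `&` B) = \int[P]_(w in A) h w)%E ->
  {ae P, forall w, P' w B = h w}.
Proof.
move=> mB mh h01 hA; have [mP' intP'] := hP'.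
have P'01 w : (0 <= P' w B <= 1)%E.
  by rewrite measure_ge0/= -(@prob_kernel _ _ _ _ _ P' w) le_measure// inE.
have int_obs (g : Omega_obs -> \bar R) (A : set Omega_obs) :
    (forall w, 0 <= g w)%E -> measurable_fun setT g -> measurable A ->
    (\int[P_obs]_(w in A) g w = \int[P]_(w in A) g w)%E.
  move=> g0 mg mA; rewrite /P_obs /distribution.
  rewrite (@ge0_integral_pushforward _ _ _ _ R _ measurable_id_obs P A g)//.
  exact: measurable_funTS.
have [||M [mM M0 MB]] := @integral_ae_eq _ _ R P_obs setT measurableT
    (fun w => P' w B) h _ (mP' B mB).
- apply: (@le_integrable _ _ _ _ setT measurableT _ (cst 1%E)) => //.
    by move=> w _; have /andP[h0 h1] := h01 w; rewrite gee0_abs//= ?normr1.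
  exact: finite_measure_integrable_cst.
- move=> A _ mA; rewrite (int_obs h A)//; last by move=> w; case/andP: (h01 w).
  rewrite (int_obs (fun w => P' w B) A)//; first by rewrite intP'// hA.
  exact: mP'.
exists M; split => //; first exact: measurable_Omega_obs.
by move=> w /= wB; apply: MB => /= /(_ I) /esym.
Qed.

(** Each factor of the product law meets a nontrivial side of at most one of the
    two boxes. *)
Lemma product_law_indep (A B : nat -> set (X * Y)) (m : nat) :
  (forall n, measurable (A n)) -> (forall n, measurable (B n)) ->
  (forall n, A n = setT \/ B n = setT) ->
  P (box A (m * N) `&` box B (m * N)) = (P (box A (m * N)) * P (box B (m * N)))%E.
Proof.
move=> mA mB AB; rewrite boxI.
have Pbox C : (forall n, measurable (C n)) -> P (box C (m * N)) =
    (\prod_(j < m) \prod_(i < N) Pi i (C (i + j * N)%N))%E.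
  by move=> mC; exact: hP.
rewrite !Pbox//; last by move=> n; exact: measurableI.
rewrite -big_split/=; apply: eq_bigr => j _; rewrite -big_split/=.
apply: eq_bigr => i _; case: (AB (i + j * N)%N) => ->.
  by rewrite setTI probability_setT mul1e.
by rewrite setIT probability_setT mule1.
Qed.

(** Both sides are finite measures in [A]; they agree on boxes of length [N],
    which generate the observable sigma-algebra. *)
Lemma obs_unobserved_indep (A : set Omega_obs) (C : set (X * Y)) n : (N <= n)%N ->
  measurable A -> measurable C ->
  P (A `&` [set w | C (obs w n)]) = (P A * P [set w | C (obs w n)])%E.
Proof.
move=> Nn mA mC; set B := [set w | _].
have mB : measurable (B : set Omega).
  by rewrite /B -[X in measurable X]setTI; exact: measurable_obs.
pose m1 := pushforward (mrestr P mB) id_obs.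
pose p := NngNum (fine_ge0 (measure_ge0 P B)).
have pE : p%:num%:E = P B by rewrite /= fineK// fin_num_measure.
pose m2 := mscale p P_obs.
rewrite muleC -pE -[LHS]/(m1 A) -[RHS]/(m2 A).
pose G : set (set Omega_obs) :=
  [set E | exists A, (forall n, measurable (A n)) /\ E = box A N].
have NM : (N <= (n %/ N).+1 * N)%N by rewrite leq_pmull.
have nM : (n < (n %/ N).+1 * N)%N by rewrite -ltn_divLR.
have BE : B = box (fun i => if i == n then C else setT) ((n %/ N).+1 * N).
  apply/seteqP; split => [w Cw i _|w /(_ n nM)]; last by rewrite eqxx.
  by case: eqP => // ->.
move: A mA; apply: (@measure_unique _ _ _ G (fun=> setT)) => //.
- apply/seteqP; split; apply: smallest_sub.
  + exact: smallest_sigma_algebra.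
  + move=> _ [i [D [iN mD ->]]]; apply: sub_sigma_algebra.
    exists (fun j => if j == i then D else setT); split.
      by move=> j; case: ifP.
    apply/seteqP; split => w /=.
      by move=> Dw j _; case: eqP => // ->.
    by move/(_ i); rewrite eqxx; apply.
  + exact: sigma_algebra_measurable.
  + move=> _ [D [mD ->]].
    rewrite (_ : box D N = \bigcap_(i in `I_N) [set w : Omega_obs | D i (obs w i)]).
      apply: bigcap_measurableType => i iN; apply: sub_sigma_algebra.
      by exists i, (D i); split.
    by apply/seteqP; split => w h i iN; exact: h.
- move=> _ _ [D [mD ->]] [E [mE ->]]; rewrite boxI.
  by eexists; split; last reflexivity; move=> i; exact: measurableI.
- by move=> _; exists (fun=> setT); split => //; apply/seteqP; split.
- by apply/seteqP; split => // w _; exists 0%N.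
- move=> _ [D [mD ->]]; rewrite -[LHS]/(P (box D N `&` B)).
  rewrite -[RHS]/(p%:num%:E * P (box D N))%E pE muleC.
  rewrite (boxE D NM) BE; apply: product_law_indep => i.
  + by case: ifP.
  + by case: ifP.
  + case: ifP => iN; last by left.
    by right; case: eqP => // ni; move: iN; rewrite ni ltnNge Nn.
- move=> i; rewrite /m1 /= /pushforward /mrestr/= preimage_setT setTI.
  by rewrite ltey_eq fin_num_measure.
Qed.

(** A rotation of the column of [n] brings the index [n %% N] to [n]. *)
Lemma probability_obs_mod n (A : set (X * Y)) : measurable A ->
  P [set w | A (obs w n)] = P [set w | A (obs w (n %% N)%N)].
Proof.
move=> mA; rewrite -[RHS](@product_law_shift _ _ _ _ _ N N0 Pi P hP (n %/ N)
  (fun=> (n %/ N)%N)); last first.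
  by rewrite -[X in measurable X]setTI; exact: measurable_obs.
suff E : cyclic_shift N (n %/ N) (fun=> (n %/ N)%N) (n %% N) = n.
  by congr (P _); apply/seteqP; split => w /=; rewrite /permute /obs E.
rewrite -[(n %% N)%N]addn0 -(mul0n N) cyclic_shift_block ?ltn_mod//.
by rewrite add0n (@modn_small (n %/ N))// addnC -divn_eq.
Qed.

(** The laws of single observations under the conditional law are enough for
    the whole proof: error rates are sums of functions of one observation, and
    the exceptional sets are handled through their probability alone. *)
Definition conditional_marginals (w : Omega) : Prop :=
  forall n (A : set (X * Y)), measurable A ->
    P' w [set w' | A (obs w' n)] =
    if (n < N)%N then \d_(obs w n) A else P [set w' | A (obs w' (n %% N)%N)].

(** For a fixed event on one observation, its indicator (if that observation
    belongs to the first sample) or its probability (if not) is a version of the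
    conditional probability.  A countable determining class makes the null set
    independent of the event, hence of any classifier. *)
Lemma conditional_marginals_ae : countably_generated (X * Y)%type ->
  {ae P, forall w, conditional_marginals w}.
Proof.
move=> /(@countable_determining_class _ _ R)[C [mC hC]].
have mO n A : measurable A -> measurable [set w : Omega | A (obs w n)].
  by move=> mA; rewrite -[X in measurable X]setTI; exact: measurable_obs.
have : {ae P, forall w, forall n i, let A := odflt setT (omap C (unpickle i)) in
    P' w [set w' | A (obs w' n)] = if (n < N)%N then \d_(obs w n) A
      else P [set w' | A (obs w' n)]}.
  apply: ae_foralln => n; apply: ae_foralln => i; cbn zeta.
  set A := odflt setT _.
  have mA : measurable A by rewrite /A; case: (unpickle i) => [s|] //=; exact: mC.
  have inA w : (obs w n \in A) = (w \in [set w : Omega | A (obs w n)]).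
    by apply/idP/idP; rewrite !inE.
  have [nN|nN] := ltnP n N.
    apply: (@regular_conditional_ae _ (fun w : Omega_obs => \d_(obs w n) A)).
    + exact: mO.
    + rewrite (_ : (fun w => _) = fun w : Omega_obs => (\1_[set w | A (obs w n)] w)%:E).
        apply/measurable_EFinP/measurable_indic; apply: sub_sigma_algebra.
        by exists n, A.
      by apply/funext => w; rewrite diracE indicE inA.
    + by move=> w; rewrite diracE; case: (_ \in _); rewrite ?lexx ?lee01.
    + move=> D mD.
      rewrite (_ : (fun w => _) = fun w : Omega => (\1_[set w | A (obs w n)] w)%:E).
        by rewrite setIC integral_indic//; [exact: measurable_Omega_obs|exact: mO].
      by apply/funext => w; rewrite diracE indicE inA.
  apply: (@regular_conditional_ae _ (cst (P [set w' | A (obs w' n)]))).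
  + exact: mO.
  + exact: measurable_cst.
  + by move=> w; rewrite measure_ge0 probability_le1//; exact: mO.
  + move=> D mD; rewrite integral_cst; last exact: measurable_Omega_obs.
    by rewrite muleC; exact: obs_unobserved_indep.
apply: filterS => w h n A mA.
have hs s : P' w [set w' | C s (obs w' n)] = if (n < N)%N then \d_(obs w n) (C s)
      else P [set w' | C s (obs w' n)].
  by have := h n (pickle s); rewrite pickleK.
pose obsn : {mfun Omega >-> (X * Y)%type} := mfun_Sub (mem_set (measurable_obs n)).
have Poo : (pushforward (P' w) obsn setT < +oo)%E.
  by rewrite /pushforward preimage_setT (@prob_kernel _ _ _ _ _ P' w) ltry.
case: ifP hs => nN hs.
  exact: (hC (pushforward (P' w) obsn) (\d_(obs w n)) Poo hs A mA).
rewrite -probability_obs_mod//.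
exact: (hC (pushforward (P' w) obsn) (distribution P obsn) Poo hs A mA).
Qed.

End Conditional.

(** * Measurability of atypical error patterns *)

Section Measurability.

Lemma measurable_set_bool d (T : measurableType d) (b : T -> bool) :
  measurable_fun setT b -> measurable [set t | b t].
Proof. by move=> /(_ measurableT [set true] I); rewrite setTI. Qed.

Lemma measurable_fun_natr d (T : measurableType d) (R : realType) (A : T -> bool) :
  measurable [set t | A t] -> measurable_fun setT (fun t => (A t)%:R : R).
Proof.
move=> mA; rewrite (_ : (fun t => _) = \1_[set t | A t]); first exact: measurable_indic.
apply/funext => t; rewrite indicE; congr (nat_of_bool _)%:R.
by apply/idP/idP; rewrite inE.
Qed.

(** Equality is a countable union of rectangles because [Y] is finite and
    discrete; for an arbitrary [Y] the diagonal need not be measurable. *)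
Lemma measurable_eq_finite d d' (T : measurableType d) (Y : measurableType d')
    (a b : T -> Y) :
  finite_set [set: Y] -> (forall A : set Y, measurable A) ->
  measurable_fun setT a -> measurable_fun setT b -> measurable [set t | a t = b t].
Proof.
move=> finY dY ma mb.
rewrite (_ : [set t | _] = \bigcup_(y in [set: Y]) (a @^-1` [set y] `&` b @^-1` [set y])).
  apply: fin_bigcup_measurable => // y _; apply: measurableI.
    by rewrite -[X in measurable X]setTI; apply: ma.
  by rewrite -[X in measurable X]setTI; apply: mb.
apply/seteqP; split => [t /= ab|t [y _ /= [-> ->]]//].
by exists (a t).
Qed.

(** The inequality is strict and continuous in [lambda]: a rational [lambda]
    satisfies it too, and the union over [lambda] becomes countable. *)
Lemma atypical_rat (R : realType) N k (x : R) e : atypical N k x e ->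
  exists2 q : rat, 0 < (ratr q : R) &
    (1 - (1 - expR (- (ratr q / N%:R))) * mean R (k.+1 * N) e) ^+ N
      < x * expR (- (ratr q * mean R N e)).
Proof.
move=> [l l0 lt]; set m := mean R (k.+1 * N) e in lt *; set r := mean R N e in lt *.
pose F (y : R) : R := x * expR (- (y * r)) - (1 - (1 - expR (- (y / N%:R))) * m) ^+ N.
have cF : continuous F.
  have cE (c : R) (y : R) : expR (- (z * c)) @[z --> y] --> expR (- (y * c)).
    apply: continuous_cvg; first exact: continuous_expR.
    by apply: cvgN; apply: cvgM; [exact: cvg_id|exact: cvg_cst].
  move=> y; apply: cvgB; first by apply: cvgM; [exact: cvg_cst|exact: cE].
  apply: (@continuous_cvg _ R R _ _ (fun z => 1 - (1 - expR (- (z / N%:R))) * m)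
    (fun z => z ^+ N)); first exact: exprn_continuous.
  apply: cvgB; first exact: cvg_cst.
  apply: cvgM; last exact: cvg_cst.
  by apply: cvgB; [exact: cvg_cst|exact: cE].
have Fl : 0 < F l by rewrite subr_gt0.
have oF : open [set y | 0 < F y /\ 0 < y].
  apply: openI; last exact: open_gt.
  by apply: (@open_comp _ _ F [set z | 0 < z]) => [z _|]; [exact: cF|exact: open_gt].
have [|y [[Fy y0] [q _ qy]]] := dense_rat (R := R) _ oF; first by exists l.
by exists q; rewrite qy// -subr_gt0.
Qed.

Variables (dW dT dX dY : measure_display).
Variables (W : measurableType dW) (Theta : measurableType dT).

Lemma measurable_atypical (R : realType) (N k : nat) (x : W -> R)
    (e : W -> nat -> bool) :
  measurable_fun setT x -> (forall n, measurable [set w | e w n]) ->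
  measurable [set w | atypical N k (x w) (e w)].
Proof.
move=> mx me.
have mmean n : measurable_fun setT (fun w => mean R n (e w)).
  rewrite /mean; apply: measurable_funM => //.
  by apply: measurable_sum => i; exact: measurable_fun_natr.
pose B (q : rat) := [set w | (1 - (1 - expR (- (ratr q / N%:R))) *
  mean R (k.+1 * N) (e w)) ^+ N < x w * expR (- (ratr q * mean R N (e w)))].
rewrite (_ : [set w | _] = \bigcup_q (if 0 < (ratr q : R) then B q else set0)).
  apply: bigcupT_measurable_rat => q; case: ifP => // _; apply: measurable_set_bool.
  apply: measurable_fun_ltr.
    by apply: measurable_funX; apply: measurable_funB => //; exact: measurable_funM.
  apply: measurable_funM => //; apply: measurableT_comp => //.
  by apply: measurableT_comp => //; exact: measurable_funM.
apply/seteqP; split => w /=.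
  by move=> /atypical_rat[q q0 qlt]; exists q => //; rewrite q0.
by move=> [q _]; case: ifP => // q0 qlt; exists (ratr q).
Qed.

End Measurability.

(** * The probability that some classifier is exceptional *)

Lemma integral_cst_probability d (T : measurableType d) (R : realType)
    (P : probability T R) (c : \bar R) : (\int[P]_w c = c)%E.
Proof. by rewrite integral_cst//= probability_setT mule1. Qed.

Section ParameterKernel.
Context {d1 d2 d3 : measure_display} {T1 : measurableType d1}
  {T2 : measurableType d2} {T3 : measurableType d3} {R : realType}.
Variable kappa : R.-pker T1 ~> T3.

(** [kappa] with a dummy parameter in [T2].  Sections of a measurable set along
    the pair (argument of [kappa], parameter) are then handled by the theory of
    kernels, which yields measurability jointly in both. *)
Definition parameter_kernel (z : T1 * T2) : {measure set T3 -> \bar R} := kappa z.1.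

Let measurable_parameter_kernel U : measurable U ->
  measurable_fun setT (parameter_kernel ^~ U).
Proof.
by move=> mU; exact: (measurableT_comp (measurable_kernel kappa U mU) measurable_fst).
Qed.

HB.instance Definition _ := isKernel.Build _ _ _ _ R parameter_kernel
  measurable_parameter_kernel.

Let parameter_kernelT z : parameter_kernel z setT = 1%E.
Proof. exact: prob_kernel. Qed.

HB.instance Definition _ := Kernel_isProbability.Build _ _ _ _ R parameter_kernel
  parameter_kernelT.

Lemma measurable_kernel_xsection (D : set ((T1 * T2) * T3)) : measurable D ->
  measurable_fun setT (fun z => kappa z.1 (xsection D z)).
Proof.
move=> mD; apply: (@measurable_fun_xsection_finite_kernel _ _ _ _ R parameter_kernel).
by rewrite inE.
Qed.

End ParameterKernel.

Section Deviation.
Context {R : realType} {dX dY dT : measure_display}.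
Context {X : measurableType dX} {Y : measurableType dY} {Theta : measurableType dT}.
Local Notation Omega := (Omega X Y).
Hypothesis finY : finite_set [set: Y].
Hypothesis discreteY : forall A : set Y, measurable A.
Variable f : Theta -> X -> Y.
Hypothesis mf : measurable_fun [set: Theta * X] (fun p : Theta * X => f p.1 p.2).

Definition err (theta : Theta) (w : Omega) (n : nat) : bool :=
  f theta (obs w n).1 != (obs w n).2.

Lemma measurable_prediction d (T : measurableType d) (g : T -> Theta) (h : T -> Omega) n :
  measurable_fun setT g -> measurable_fun setT h ->
  measurable_fun setT (fun t => f (g t) (obs (h t) n).1).
Proof.
move=> mg mh.
have mp : measurable_fun setT (fun t => (g t, (obs (h t) n).1)); last first.
  exact: (measurableT_comp mf mp).
apply: measurable_fun_pair => //.
apply: (measurableT_comp measurable_fst).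
exact: (measurableT_comp (measurable_obs n) mh).
Qed.

Lemma measurable_err d (T : measurableType d) (g : T -> Theta) (h : T -> Omega) n :
  measurable_fun setT g -> measurable_fun setT h ->
  measurable [set t | err (g t) (h t) n].
Proof.
move=> mg mh.
rewrite (_ : [set t | _] = ~` [set t | f (g t) (obs (h t) n).1 = (obs (h t) n).2]).
  apply: measurableC; apply: measurable_eq_finite => //.
    exact: measurable_prediction.
  apply: (measurableT_comp measurable_snd).
  exact: (measurableT_comp (measurable_obs n) mh).
by apply/seteqP; split => t /=; rewrite /err => /eqP.
Qed.

Variables (N k : nat).
Hypothesis N0 : (0 < N)%N.
Variable pik : R.-pker Omega ~> Theta.

Lemma measurable_Delta_graph :
  measurable [set z : (Omega * Theta) * Theta | Delta N f k z.1.1 z.1.2 z.2].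
Proof.
rewrite (_ : [set z | _] = \bigcap_(i in `I_(k.+1 * N))
  [set z | f z.2 (obs z.1.1 i).1 = f z.1.2 (obs z.1.1 i).1]).
  apply: bigcap_measurableType => i _; apply: measurable_eq_finite => //.
    apply: measurable_prediction; first exact: measurable_snd.
    exact: (measurableT_comp measurable_fst measurable_fst).
  apply: measurable_prediction; first exact: (measurableT_comp measurable_snd measurable_fst).
  exact: (measurableT_comp measurable_fst measurable_fst).
by apply/seteqP; split => z h i iN; exact: h.
Qed.

Lemma Delta_xsection z : Delta N f k z.1 z.2 =
  xsection [set z : (Omega * Theta) * Theta | Delta N f k z.1.1 z.1.2 z.2] z.
Proof. by apply/seteqP; split => t; rewrite /xsection /= inE. Qed.

Lemma measurable_Delta w theta : measurable (Delta N f k w theta).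
Proof.
rewrite (Delta_xsection (w, theta)); apply: measurable_xsection.
exact: measurable_Delta_graph.
Qed.

Definition mass (w : Omega) (theta : Theta) : R :=
  fine (pik w (Delta N f k w theta)).

Lemma massE w theta : pik w (Delta N f k w theta) = (mass w theta)%:E.
Proof.
by rewrite /mass fineK//; apply: finite_kernel_measure; exact: measurable_Delta.
Qed.

Lemma mass_ge0 w theta : 0 <= mass w theta.
Proof. exact: fine_ge0. Qed.

Lemma mass_le1 w theta : mass w theta <= 1.
Proof.
rewrite -lee_fin -massE -(@prob_kernel _ _ _ _ _ pik w).
by apply: le_measure => //; rewrite inE//; exact: measurable_Delta.
Qed.

Lemma measurable_mass : measurable_fun setT (fun z : Omega * Theta => mass z.1 z.2).
Proof.
apply/measurable_EFinP; rewrite (_ : _ \o _ = fun z : Omega * Theta => pik z.1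
  (xsection [set z : (Omega * Theta) * Theta | Delta N f k z.1.1 z.1.2 z.2] z)).
  by apply: measurable_kernel_xsection; exact: measurable_Delta_graph.
by apply/funext => z /=; rewrite -massE Delta_xsection.
Qed.

Definition exceptional (delta : R) (w : Omega) (theta : Theta) : Prop :=
  atypical N k (delta * mass w theta) (err theta w).

(** The division by the mass counts every class of classifiers with equal
    predictions once, whatever its mass: a class of exceptional classifiers has
    total weight 1 ([total_weight_ge1]), while averaging over the rotations
    turns the indicator into at most [delta] times the mass
    ([sum_weight_shifts_le]). *)
Definition weight (delta : R) (w : Omega) (theta : Theta) : R :=
  `[< exceptional delta w theta >]%:R / mass w theta.

Lemma weight_ge0 delta w theta : 0 <= weight delta w theta.
Proof. by rewrite divr_ge0// mass_ge0. Qed.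

Lemma measurable_weight delta :
  measurable_fun setT (fun z : Omega * Theta => weight delta z.1 z.2).
Proof.
have mass_m := measurable_mass.
have mexc : measurable [set z : Omega * Theta | exceptional delta z.1 z.2].
  apply: measurable_atypical; first by apply: measurable_funM.
  by move=> n; apply: measurable_err.
apply: measurable_funM.
  apply: measurable_fun_natr; rewrite (_ : [set z | _] =
    [set z : Omega * Theta | exceptional delta z.1 z.2])//.
  by apply/seteqP; split => z /asboolP.
(* Away from 0 the inverse is the measurable function [expR (- ln _)]. *)
rewrite (_ : (fun z => _) = fun z : Omega * Theta =>
    if mass z.1 z.2 == 0 then 0 else expR (- ln (mass z.1 z.2))).
  apply: measurable_fun_ifT => //; first exact: measurable_fun_eqr.
  apply: measurableT_comp => //; apply: measurableT_comp => //.
  exact: (measurableT_comp (@measurable_ln R) mass_m).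
apply/funext => z; case: eqVneq => [->|m0]; first by rewrite invr0.
by rewrite expRN lnK// posrE lt_def m0 mass_ge0.
Qed.

Definition total_weight (delta : R) (w : Omega) : \bar R :=
  (\int[pik w]_theta (weight delta w theta)%:E)%E.

Lemma measurable_total_weight delta : measurable_fun setT (total_weight delta).
Proof.
apply: (measurable_fun_integral_finite_kernel
  (fun z : Omega * Theta => (weight delta z.1 z.2)%:E) pik).
  by move=> z; rewrite lee_fin weight_ge0.
by apply/measurable_EFinP; exact: measurable_weight.
Qed.

Lemma measurable_weight_section delta w :
  measurable_fun setT (fun theta => (weight delta w theta)%:E).
Proof.
apply/measurable_EFinP.
exact: (measurableT_comp (measurable_weight delta) (pair1_measurable w)).
Qed.

(** Together with [DeltaC] it shows that being exceptional only depends on the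
    class of the classifier. *)
Lemma eq_atypical (x : R) (e1 e2 : nat -> bool) :
  (forall n, (n < k.+1 * N)%N -> e1 n = e2 n) -> atypical N k x e1 -> atypical N k x e2.
Proof.
move=> e12 [l l0 lt]; exists l => //.
rewrite /mean; under eq_bigr do rewrite -e12//.
rewrite (eq_bigr (fun i : 'I_N => (e1 i)%:R)); first exact: lt.
by move=> i _; rewrite e12// (leq_trans (ltn_ord i))// leq_pmull.
Qed.

Lemma DeltaC w theta theta' : Delta N f k w theta theta' ->
  Delta N f k w theta' = Delta N f k w theta.
Proof.
by move=> h; apply/seteqP; split => t ht i iN; rewrite (ht i iN) (h i iN).
Qed.

Lemma total_weight_ge1 delta w theta : 0 <= delta ->
  exceptional delta w theta -> (1 <= total_weight delta w)%E.
Proof.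
move=> delta0 exc; set p := mass w theta.
(* At mass 0 the strict inequality of [atypical] has a right-hand side 0. *)
have p0 : 0 < p.
  rewrite lt_def mass_ge0 andbT; apply/eqP => p0; move: exc.
  rewrite /exceptional -/p p0 mulr0 => -[l l0]; rewrite mul0r ltNge exprn_ge0//.
  apply: le_trans (expRN_le_laplace _ (mean_le1 _ _ _)); first exact: expR_ge0.
  by rewrite divr_ge0// ltW.
have wE theta' : Delta N f k w theta theta' -> weight delta w theta' = p^-1.
  move=> h; rewrite /weight /mass (DeltaC h) -/p (asboolT _) ?mul1r//.
  rewrite /exceptional /mass (DeltaC h); apply: eq_atypical exc => n nM.
  by rewrite /err (h n nM).
rewrite /total_weight; apply: (@le_trans _ _
    (\int[pik w]_(t in Delta N f k w theta) (weight delta w t)%:E)%E).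
  rewrite (eq_integral (cst p^-1%:E)); last by move=> t; rewrite inE => /wE ->.
  rewrite integral_cst; last exact: measurable_Delta.
  by rewrite massE -EFinM mulVf ?lt0r_neq0.
apply: ge0_subset_integral => //; first exact: measurable_Delta.
  exact: measurable_weight_section.
by move=> t _; rewrite lee_fin weight_ge0.
Qed.

Hypothesis hpi : partially_exchangeable N k pik.

Lemma mass_shift s w theta :
  mass (permute (cyclic_shift N k s) w) theta = mass w theta.
Proof.
rewrite /mass; congr fine.
pose s' i := (k.+1 - s i %% k.+1)%N.
have s's i : ((s' i + s i) %% k.+1 = 0)%N.
  by rewrite addnC /s' -modnDml subnKC ?modnn// ltnW// ltn_mod.
have -> : Delta N f k (permute (cyclic_shift N k s) w) theta = Delta N f k w theta.
  apply/seteqP; split => t h i iM; last by apply: h; rewrite ltn_cyclic_shift.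
  have := h (cyclic_shift N k s' i); rewrite ltn_cyclic_shift// => /(_ iM).
  by rewrite /permute /obs (cyclic_shiftK N0 s's).
by apply: partially_exchangeable_shift => //; exact: measurable_Delta.
Qed.

Lemma sum_weight_shifts_le delta w theta : 0 <= delta ->
  \sum_(sg : {ffun 'I_N -> 'I_k.+1})
    weight delta (permute (cyclic_shift N k (shifts sg)) w) theta <=
  (k.+1 ^ N)%:R * delta.
Proof.
move=> delta0; rewrite /weight /exceptional; under eq_bigr do rewrite mass_shift.
rewrite -mulr_suml; have [->|p0] := eqVneq (mass w theta) 0.
  by rewrite invr0 mulr0 mulr_ge0.
have pp : 0 < mass w theta by rewrite lt_def p0 mass_ge0.
rewrite ler_pdivrMr// -mulrA.
apply: (@card_atypical_shifts_le R N k N0 (err theta w)).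
by rewrite mulr_ge0// ltW.
Qed.

Variables (Pi : 'I_N -> probability (X * Y)%type R).
Variables (P : probability Omega R) (hP : is_product_law Pi P).

(** Neither the law of the path nor the posterior changes under rotations, so
    the integral equals its average over them; under the two integrals that
    average is at most [delta]. *)
Lemma integral_total_weight_le delta : 0 <= delta ->
  (\int[P]_w total_weight delta w <= delta%:E)%E.
Proof.
move=> delta0; set K := (k.+1 ^ N)%N.
have K0 : 0 < K%:R :> R by rewrite ltr0n expn_gt0.
have tw0 w : (0 <= total_weight delta w)%E.
  by apply: integral_ge0 => t _; rewrite lee_fin weight_ge0.
have mtw := measurable_total_weight delta.
rewrite -(@lee_pmul2l _ K%:R%:E)// ?lte_fin//.
pose T (sg : {ffun 'I_N -> 'I_k.+1}) :=
  permute (X := X) (Y := Y) (cyclic_shift N k (shifts sg)).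
have -> : (K%:R%:E * \int[P]_w total_weight delta w =
    \int[P]_w \sum_(sg : {ffun 'I_N -> 'I_k.+1}) total_weight delta (T sg w))%E.
  rewrite ge0_integral_sum//; last first.
    by move=> sg; exact: (measurableT_comp mtw (measurable_permute _)).
  rewrite (eq_bigr (fun=> \int[P]_w total_weight delta w)%E); last first.
    by move=> sg _; exact: (ge0_integral_product_law_shift N0 hP).
  by rewrite sumr_const card_ffun !card_ord mule_natl.
apply: (@le_trans _ _ (\int[P]_w (K%:R * delta)%:E)%E); last first.
  by rewrite (integral_cst_probability P) EFinM.
apply: ge0_le_integral => //.
- by move=> w _; exact: sume_ge0.
- apply: emeasurable_sum => sg.
  exact: (measurableT_comp mtw (measurable_permute _)).
move=> w _.
have -> : (\sum_(sg : {ffun 'I_N -> 'I_k.+1}) total_weight delta (T sg w) =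
   \int[pik w]_theta (\sum_sg weight delta (T sg w) theta)%:E)%E.
  under eq_integral do rewrite -sumEFin.
  rewrite ge0_integral_sum//.
  - apply: eq_bigr => sg _; apply: eq_measure_integral => A mA _.
    exact: partially_exchangeable_shift.
  - by move=> sg; exact: measurable_weight_section.
  - by move=> sg t _; rewrite lee_fin weight_ge0.
apply: (@le_trans _ _ (\int[pik w]_theta (K%:R * delta)%:E)%E); last first.
  by rewrite integral_cst// (@prob_kernel _ _ _ _ _ pik w) mule1.
apply: ge0_le_integral => //.
- by move=> t _; rewrite lee_fin sumr_ge0// => sg _; exact: weight_ge0.
- apply/measurable_EFinP; apply: measurable_sum => sg.
  exact/measurable_EFinP/measurable_weight_section.
by move=> t _; rewrite lee_fin; exact: sum_weight_shifts_le.
Qed.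

(** A measurable set containing the union, over the possibly uncountable
    [Theta], of the events that [theta] is exceptional. *)
Definition exceptional_samples (delta : R) : set Omega :=
  [set w | (1 <= total_weight delta w)%E].

Lemma measurable_exceptional_samples delta : measurable (exceptional_samples delta).
Proof.
rewrite /exceptional_samples -[X in measurable X]setTI.
exact: (emeasurable_fun_c_infty measurableT (measurable_total_weight delta)).
Qed.

Lemma probability_exceptional_samples_le delta : 0 <= delta ->
  (P (exceptional_samples delta) <= delta%:E)%E.
Proof.
move=> delta0; apply: le_trans (integral_total_weight_le delta0).
have mE := measurable_exceptional_samples delta.
have tw0 w : (0 <= total_weight delta w)%E.
  by apply: integral_ge0 => t _; rewrite lee_fin weight_ge0.
rewrite -(mul1e (P _)) -integral_cst//.
apply: (@le_trans _ _ (\int[P]_(w in exceptional_samples delta) total_weight delta w)%E).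
  apply: ge0_le_integral => //.
  by apply: measurable_funTS; exact: measurable_total_weight.
apply: ge0_subset_integral => //; exact: measurable_total_weight.
Qed.

End Deviation.

(** * Integration by layers and inversion of the exponential bound *)

Section Layers.
Variable R : realType.
Implicit Types (l L eta : nat -> R).

(** [b] marks the exceptional sets containing a path, [l] the bounds valid off
    them.  Up to the first set that the path avoids, the sum telescopes to a
    bound valid for the path, and the later terms are nonnegative. *)
Lemma le_layers (J : nat) l (b : nat -> bool) (H : R) :
  (forall j, (1 <= j <= J)%N -> l j <= l j.+1) ->
  (forall j, (1 <= j <= J)%N -> ~~ b j -> H <= l j) -> H <= l J.+1 ->
  H <= l 1%N + \sum_(1 <= j < J.+1) (b j)%:R * (l j.+1 - l j).
Proof.
elim: J H => [|J IH] H ndl Hl HU; first by rewrite big_nil addr0.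
have sub j : (1 <= j <= J)%N -> (1 <= j <= J.+1)%N.
  by move=> /andP[-> /leqW].
rewrite big_nat_recr//= addrA; case bJ : (b J.+1); last first.
  rewrite mul0r addr0; apply: IH => [j /sub /ndl//|j /sub /Hl//|].
  by apply: Hl; rewrite ?bJ// leqnn.
rewrite mul1r -lerBlDr; apply: IH => [j /sub /ndl//|j jJ bj|].
  apply: le_trans (Hl j (sub j jJ) bj).
  by rewrite lerBlDr lerDl subr_ge0 ndl//= leqnn.
by rewrite lerBlDr addrC subrK.
Qed.

(** Summation by parts: [l j] enters with the coefficient
    [eta j.-1 - eta j >= 0], or [1 - eta 1] for [j = 1], so the left-hand side is
    nondecreasing in [l].  It serves to remove a truncation of [L] at [U]. *)
Lemma layers_monotone (J : nat) l L eta (U : R) : eta 1%N <= 1 ->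
  (forall j, (1 <= j <= J)%N -> eta j.+1 <= eta j) ->
  (forall j, (1 <= j <= J.+1)%N -> l j <= L j) ->
  l 1%N + \sum_(1 <= j < J.+1) eta j * (l j.+1 - l j) + eta J.+1 * (U - l J.+1) <=
  L 1%N + \sum_(1 <= j < J.+1) eta j * (L j.+1 - L j) + eta J.+1 * (U - L J.+1).
Proof.
move=> eta1 nieta lL; rewrite -subr_ge0.
elim: J nieta lL => [|J IH] nieta lL.
  have h := lL 1%N isT; rewrite !big_nil; nra.
have {}IH : 0 <= L 1%N + \sum_(1 <= j < J.+1) eta j * (L j.+1 - L j)
    + eta J.+1 * (U - L J.+1) - (l 1%N + \sum_(1 <= j < J.+1) eta j * (l j.+1 - l j)
    + eta J.+1 * (U - l J.+1)).
  apply: IH => j /andP[j1 jJ]; first by apply: nieta; rewrite j1 leqW.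
  by apply: lL; rewrite j1 leqW.
have h1 : 0 <= eta J.+1 - eta J.+2 by rewrite subr_ge0 nieta//= leqnn.
have h2 : 0 <= L J.+2 - l J.+2 by rewrite subr_ge0 lL//= leqnn.
rewrite !(@big_nat_recr _ _ _ J.+1)//=.
by apply: le_trans IH _; rewrite -subr_ge0; have := mulr_ge0 h1 h2; nra.
Qed.

End Layers.

Section PhiInv.
Variable R : realType.

Lemma le_Phi_inv_pinfty (a m : R) : 0 < a -> m <= 1 ->
  (m%:E <= Phi_inv a +oo)%E.
Proof.
move=> a0 m1; have E1 : expR (- a) < 1 by rewrite expR_lt1 oppr_lt0.
rewrite /Phi_inv mulry gtr0_sg// mul1e /= oppr0 adde0 mul1e lee_fin.
by apply: le_trans m1 _; rewrite invf_ge1 ?subr_gt0// gerBl expR_ge0.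
Qed.

Lemma le_Phi_inv (N : nat) (lambda m q : R) : (0 < N)%N -> 0 < lambda -> m <= 1 ->
  - (N%:R * ln (1 - (1 - expR (- (lambda / N%:R))) * m)) <= lambda * q ->
  (m%:E <= Phi_inv (lambda / N%:R) q%:E)%E.
Proof.
move=> N0 l0 m1; have N0' : 0 < N%:R :> R by rewrite ltr0n.
set a := lambda / N%:R; have a0 : 0 < a by rewrite divr_gt0.
have E1 : expR (- a) < 1 by rewrite expR_lt1 oppr_lt0.
set x := 1 - _; have x0 : 0 < x.
  exact: lt_le_trans (expR_gt0 _) (expRN_le_laplace (ltW a0) m1).
move=> h; rewrite /Phi_inv /= -EFinD -EFinM lee_fin.
rewrite ler_pdivlMr ?subr_gt0// mulrC.
suff : expR (- (a * q)) <= x by rewrite /x; lra.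
rewrite -[leRHS](lnK x0) ler_expR /a lerNl mulrAC ler_pdivlMr//.
by rewrite mulNr mulrC.
Qed.

End PhiInv.

(** * Conditional expectation of error rates *)

Section ConditionalMean.
Context {R : realType} {dX dY dT : measure_display}.
Context {X : measurableType dX} {Y : measurableType dY} {Theta : measurableType dT}.
Local Notation Omega := (Omega X Y).
Hypothesis finY : finite_set [set: Y].
Hypothesis discreteY : forall A : set Y, measurable A.
Variable f : Theta -> X -> Y.
Hypothesis mf : measurable_fun [set: Theta * X] (fun p : Theta * X => f p.1 p.2).
Variable N : nat.
Hypothesis N0 : (0 < N)%N.
Variables (P : probability Omega R) (P' : R.-pker Omega ~> Omega).
Variables (w : Omega) (hw : conditional_marginals N P P' w) (theta : Theta).

Let Q := P' w.

Lemma kernel_cst (c : \bar R) : (\int[Q]_w' c = c)%E.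
Proof. by rewrite integral_cst// (@prob_kernel _ _ _ _ _ P' w) mule1. Qed.

Lemma measurable_err_sample n : measurable [set w' : Omega | err f theta w' n].
Proof.
have /(_ (cst theta) id) := measurable_err finY discreteY mf (T := Omega) n.
by apply => //; exact: measurable_cst.
Qed.

Lemma measurable_mistake : measurable [set z : X * Y | f theta z.1 != z.2].
Proof.
rewrite (_ : [set z | _] = ~` [set z : X * Y | f theta z.1 = z.2]).
  apply: measurableC; apply: measurable_eq_finite => //.
  have mp : measurable_fun setT (fun z : X * Y => (theta, z.1)).
    by apply: measurable_fun_pair => //.
  exact: (measurableT_comp mf mp).
by apply/seteqP; split => t /= /eqP.
Qed.

Lemma conditional_err n : Q [set w' | err f theta w' n] =
  if (n < N)%N then (err f theta w n)%:R%:E else P [set w' | err f theta w' (n %% N)].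
Proof.
rewrite [LHS](hw n measurable_mistake); case: ifP => // nN.
by rewrite diracE; congr (nat_of_bool _)%:R%:E; apply/idP/idP; rewrite inE.
Qed.

(** The null event for the conditional law may depend on [theta]: what has to be
    uniform in [theta] is the set of samples [w], and [conditional_marginals]
    sees to that. *)
Lemma err_observed_ae :
  {ae Q, forall w', forall n, (n < N)%N -> err f theta w' n = err f theta w n}.
Proof.
apply: ae_foralln => n; have [nN|nN] := ltnP n N; last exact: nearW.
pose D := [set z : X * Y | (f theta z.1 != z.2) != err f theta w n].
have mD : measurable D.
  rewrite /D; case: (err f theta w n).
    rewrite (_ : [set z | _] = ~` [set z : X * Y | f theta z.1 != z.2]).
      exact: measurableC measurable_mistake.
    by apply/seteqP; split => z /=; case: (f theta z.1 != z.2) => // /(_ isT).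
  rewrite (_ : [set z | _] = [set z : X * Y | f theta z.1 != z.2]).
    exact: measurable_mistake.
  by apply/seteqP; split => z /=; case: (f theta z.1 != z.2).
exists [set w' : Omega | D (obs w' n)]; split.
- by rewrite -[X in measurable X]setTI; exact: measurable_obs.
- rewrite [LHS](hw n mD) nN diracE memNset// /D /err.
  by move=> /=; rewrite eqxx.
- by move=> w' /= h; apply/eqP => ew; apply: h.
Qed.

Definition mean_risk : R := N%:R^-1 * \sum_(i < N) fine (P [set w' | err f theta w' i]).

Lemma PerrE n : P [set w' | err f theta w' n] =
  (fine (P [set w' | err f theta w' n]))%:E.
Proof. by rewrite fineK// fin_num_measure//; exact: measurable_err_sample. Qed.

Lemma integral_natr (mu : {measure set Omega -> \bar R}) n :
  (\int[mu]_w' (err f theta w' n)%:R%:E = mu [set w' | err f theta w' n])%E.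
Proof.
rewrite -[in RHS](setIT [set _ | _]) -integral_indic//; last exact: measurable_err_sample.
apply: eq_integral => w' _; rewrite indicE; congr (nat_of_bool _)%:R%:E.
by apply/idP/idP; rewrite inE.
Qed.

Lemma integral_mean (mu : {measure set Omega -> \bar R}) n :
  (\int[mu]_w' (mean R n (err f theta w'))%:E =
   (n%:R^-1)%:E * \sum_(i < n) mu [set w' | err f theta w' i])%E.
Proof.
under eq_integral do rewrite EFinM -sumEFin.
have mi i : measurable_fun setT (fun w' : Omega => (err f theta w' i)%:R%:E : \bar R).
  by apply/measurable_EFinP; apply: measurable_fun_natr; exact: measurable_err_sample.
rewrite ge0_integralZl//; last 2 first.
- exact: emeasurable_sum.
- by move=> w' _; apply: sume_ge0 => i _; rewrite lee_fin.
rewrite ge0_integral_sum//.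
by congr (_ * _)%E; apply: eq_bigr => i _; exact: integral_natr.
Qed.

Lemma riskE : risk N P f theta = mean_risk%:E.
Proof.
rewrite /risk expectation.unlock.
transitivity (\int[P]_w' (mean R N (err f theta w'))%:E)%E => //.
rewrite integral_mean /mean_risk EFinM -sumEFin; congr (_ * _)%E.
by apply: eq_bigr => i _; exact: PerrE.
Qed.

(** The first of the [k + 1] samples is the observed one, the others are
    independent of it. *)
Lemma conditional_mean k :
  (\int[Q]_w' (mean R (k.+1 * N) (err f theta w'))%:E =
   ((r1 N f theta w + k%:R * mean_risk) / k.+1%:R)%:E)%E.
Proof.
rewrite integral_mean.
pose F n : R := if (n < N)%N then (err f theta w n)%:R
   else fine (P [set w' | err f theta w' (n %% N)]).
rewrite (eq_bigr (fun n : 'I__ => (F n)%:E)); last first.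
  by move=> n _; rewrite conditional_err /F; case: ifP => // _; exact: PerrE.
rewrite sumEFin -EFinM; congr _%:E.
rewrite (sum_blocks N F) (eq_bigr (fun i : 'I_N => (err f theta w i)%:R +
  k%:R * fine (P [set w' | err f theta w' i]))); last first.
  move=> i _; rewrite big_ord_recl mul0n addn0 {1}/F ltn_ord; congr (_ + _).
  rewrite (eq_bigr (fun=> fine (P [set w' | err f theta w' i]))).
    by rewrite sumr_const card_ord mulr_natl.
  move=> j _; rewrite /F lift0 ltnNge mulSn addnCA leq_addr /=.
  by rewrite modnDl addnC modnMDl modn_small.
rewrite big_split/= -mulr_sumr /r1 /mean_risk natrM -/(err f theta w _).
by field; rewrite nat1r !pnatr_eq0 /= -lt0n N0.
Qed.

End ConditionalMean.

(** * The bound given the first sample *)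

Section ConditionalBound.
Context {R : realType} {dX dY dT : measure_display}.
Context {X : measurableType dX} {Y : measurableType dY} {Theta : measurableType dT}.
Local Notation Omega := (Omega X Y).
Hypothesis finY : finite_set [set: Y].
Hypothesis discreteY : forall A : set Y, measurable A.
Variable f : Theta -> X -> Y.
Hypothesis mf : measurable_fun [set: Theta * X] (fun p : Theta * X => f p.1 p.2).
Variables (N k : nat).
Hypothesis N0 : (0 < N)%N.
Hypothesis k0 : (0 < k)%N.
Variables (P : probability Omega R) (P' : R.-pker Omega ~> Omega).
Variable pik : R.-pker Omega ~> Theta.
Variables (w : Omega) (hw : conditional_marginals N P P' w) (theta : Theta).
Variables (eps : R) (J : nat) (eta : nat -> R).
Hypothesis eps_gt0 : 0 < eps.
Hypothesis eps_le1 : eps <= 1.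
Hypothesis eta1_lt1 : eta 1%N < 1.
Hypothesis eta_decr : forall j, (1 <= j < J.+1)%N -> eta j.+1 < eta j.
Hypothesis etaJ_gt0 : 0 < eta J.+1.

Let Q := P' w.

(** Chosen so that [level j / eta j] sums to [eps] over all [1 <= j <= J.+1] and
    [k >= 1]. *)
Definition level (j : nat) : R := eps * eta j / (J.+1%:R * (k * k.+1)%:R).

Hypothesis hB : forall j, (1 <= j <= J.+1)%N ->
  (Q (exceptional_samples f N k pik (level j)) <= (eta j)%:E)%E.

Lemma eta_gt0 j : (1 <= j <= J.+1)%N -> 0 < eta j.
Proof.
move=> /andP[j1 jJ]; have -> : j = (J.+1 - (J.+1 - j))%N by rewrite subKn.
have : (J.+1 - j <= J)%N by rewrite leq_subLR -addn1 addnC leq_add2r.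
elim: (J.+1 - j)%N => [|d IH] dJ; first by rewrite subn0.
apply: lt_trans (IH (ltnW dJ)) _.
rewrite (_ : (J.+1 - d = (J.+1 - d.+1).+1)%N); last by rewrite subSS subSn// ltnW.
by apply: eta_decr; rewrite subSS subn_gt0 dJ ltnS leq_subr.
Qed.

Let K0 : 0 < J.+1%:R * (k * k.+1)%:R :> R.
Proof. by rewrite mulr_gt0 ?ltr0n// muln_gt0 k0. Qed.

Lemma level_gt0 j : (1 <= j <= J.+1)%N -> 0 < level j.
Proof. by move=> jJ; rewrite divr_gt0// mulr_gt0// eta_gt0. Qed.

Lemma ln_levelE j : (1 <= j <= J.+1)%N ->
  ln (level j) = ln eps + ln (eta j) - ln J.+1%:R - ln (k * k.+1)%:R.
Proof.
move=> jJ; have kk : 0 < (k * k.+1)%:R :> R by rewrite ltr0n muln_gt0 k0.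
have e0 := eta_gt0 jJ; have J0 : 0 < J.+1%:R :> R by [].
by rewrite /level ln_div ?posrE ?mulr_gt0// !lnM ?posrE//; lra.
Qed.

Definition neglog_mass (w' : Omega) : \bar R :=
  (- lne (eps%:E * pik w' (Delta N f k w' theta)))%E.

Local Notation p := (fun w' => mass f N k pik w' theta).

Lemma neglog_massE w' : neglog_mass w' =
  if 0 < p w' then (- ln eps - ln (p w'))%:E else +oo%E.
Proof.
rewrite /neglog_mass (massE finY discreteY mf) -EFinM; case: ifP => p0.
  by rewrite lne_EFin ?mulr_gt0// lnM ?posrE// -EFinN opprD.
rewrite le0_lneNy// lee_fin.
by have := mass_ge0 f N k pik w' theta; rewrite le_eqVlt p0 orbF => /eqP <-; rewrite mulr0.
Qed.

Lemma neglog_mass_ge0 w' : (0 <= neglog_mass w')%E.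
Proof.
rewrite neglog_massE; case: ifP => // p0; rewrite lee_fin.
have := mass_le1 finY discreteY mf N k pik w' theta.
by move=> /ln_le0; have := ln_le0 eps_le1; lra.
Qed.

Lemma measurable_posterior_mass : measurable_fun setT p.
Proof.
have mm := measurable_mass finY discreteY mf N k pik.
exact: (measurableT_comp mm (pair2_measurable theta)).
Qed.

Lemma measurable_neglog_mass : measurable_fun setT neglog_mass.
Proof.
rewrite (funext neglog_massE).
apply: measurable_fun_ifT.
- by apply: measurable_fun_ltr => //; exact: measurable_posterior_mass.
- apply/measurable_EFinP; apply: measurable_funB => //.
  exact: (measurableT_comp (@measurable_ln R) measurable_posterior_mass).
- exact: measurable_cst.
Qed.

Lemma d'E : d' N f P' eps k pik theta w = (\int[Q]_w' neglog_mass w')%E.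
Proof.
rewrite -[RHS]oppeK -integral_ge0N; last by move=> w' _; exact: neglog_mass_ge0.
by rewrite /d'; congr (- _)%E; apply: eq_integral => w' _; rewrite /neglog_mass oppeK.
Qed.

Variables (lambda : R).
Hypothesis lambda_gt0 : 0 < lambda.

(** Abbreviations for the bound at one [lambda]: [m] is the conditional mean of
    the error rate over the [k + 1] samples, and [x0] that of [x].  The excess
    [- N * ln x - lambda * r + ln p] is at most [U] everywhere and at most [L j]
    off [B j]; [l] truncates [L] at [U] to make the staircase nondecreasing up to
    its last step [U]. *)
Let a := lambda / N%:R.
Let c := 1 - expR (- a).
Let r : R := r1 N f theta w.
Let m := (r + k%:R * mean_risk f N P theta) / k.+1%:R.
Let x w' := 1 - c * mean R (k.+1 * N) (err f theta w').
Let U := lambda * (1 - r).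
Let L j := - ln (level j).
Let l j := if (j <= J.+1)%N then Num.min U (L j) else U.
Let B j := exceptional_samples f N k pik (level j).

Let a0 : 0 < a. Proof. by rewrite divr_gt0// ltr0n. Qed.

Let c01 : 0 < c < 1.
Proof. by rewrite /c subr_gt0 gtrBl expR_gt0 expR_lt1 oppr_lt0 a0. Qed.

Let r01 : 0 <= r <= 1.
Proof.
apply/andP; split; first exact: (mean_ge0 R N (err f theta w)).
exact: (mean_le1 R N (err f theta w)).
Qed.

Let U0 : 0 <= U. Proof. by rewrite mulr_ge0 ?(ltW lambda_gt0)// subr_ge0; case/andP: r01. Qed.

Let expR_le_x w' : expR (- a) <= x w'.
Proof. by apply: expRN_le_laplace; [exact: ltW|exact: mean_le1]. Qed.

Let x_gt0 w' : 0 < x w'. Proof. exact: lt_le_trans (expR_gt0 _) (expR_le_x w'). Qed.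

Let measurable_mean n : measurable_fun setT (fun w' : Omega => mean R n (err f theta w')).
Proof.
apply: measurable_funM => //; apply: measurable_sum => i.
by apply: measurable_fun_natr; exact: (measurable_err_sample finY discreteY mf).
Qed.

Let m01 : 0 <= m <= 1.
Proof.
have h := conditional_mean finY discreteY mf N0 hw theta k.
rewrite -!lee_fin /m -h; apply/andP; split.
  by apply: integral_ge0 => w' _; rewrite lee_fin mean_ge0.
rewrite -[leRHS](kernel_cst P' w); apply: ge0_le_integral => //.
- by move=> w' _; rewrite lee_fin mean_ge0.
- exact/measurable_EFinP.
- by move=> w' _; rewrite lee_fin mean_le1.
Qed.

Let x0 := 1 - c * m.

Let x0_gt0 : 0 < x0.
Proof.
apply: lt_le_trans (expR_gt0 _) (expRN_le_laplace (ltW a0) _).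
by case/andP: m01.
Qed.

Let integral_x : (\int[Q]_w' (x w')%:E = x0%:E)%E.
Proof.
have cm : (\int[Q]_w' (c * mean R (k.+1 * N) (err f theta w'))%:E = (c * m)%:E)%E.
  under eq_integral do rewrite EFinM.
  rewrite ge0_integralZl//.
  - by rewrite (conditional_mean finY discreteY mf N0 hw) -EFinM.
  - exact/measurable_EFinP.
  - by move=> w' _; rewrite lee_fin mean_ge0.
  - by rewrite lee_fin; case/andP: c01 => /ltW.
(* Adding the nonnegative term that [x] subtracts keeps all integrands
   nonnegative. *)
have : (\int[Q]_w' ((x w')%:E + (c * mean R (k.+1 * N) (err f theta w'))%:E) = 1)%E.
  rewrite -[RHS](kernel_cst P' w); apply: eq_integral => w' _.
  by rewrite -EFinD /x subrK.
rewrite ge0_integralD//.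
- rewrite cm; case: (\int[Q]_w' (x w')%:E)%E => [y| |]//= [yE].
  by congr _%:E; rewrite /x0 -yE addrK.
- by move=> w' _; rewrite lee_fin ltW.
- by apply/measurable_EFinP; apply: measurable_funB => //; exact: measurable_funM.
- move=> w' _; rewrite lee_fin mulr_ge0 ?mean_ge0//.
  by case/andP: c01 => /ltW.
- by apply/measurable_EFinP; exact: measurable_funM.
Qed.

Let l_le_L j : (1 <= j <= J.+1)%N -> l j <= L j.
Proof. by move=> /andP[_ jJ]; rewrite /l jJ ge_min lexx orbT. Qed.

Let ndl j : (1 <= j <= J.+1)%N -> l j <= l j.+1.
Proof.
move=> jJ; have /andP[j1 jJ'] := jJ; rewrite /l jJ'.
case: ifP => j2; last by rewrite ge_min lexx.
have LL : L j <= L j.+1.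
  rewrite /L lerN2 ler_ln ?posrE ?level_gt0// /level ler_pM2r ?invr_gt0//.
  by rewrite ler_pM2l// ltW// eta_decr// j1.
by rewrite le_min !ge_min lexx LL orbT.
Qed.

Let l1_ge0 : 0 <= l 1%N.
Proof.
rewrite /l /= le_min U0 /= /L oppr_ge0 ln_le0// /level ler_pdivrMr// mul1r.
apply: (@le_trans _ _ 1).
  have e1 := eta_gt0 (isT : (1 <= 1 <= J.+1)%N).
  by rewrite mulr_ile1 ?(ltW e1) ?(ltW eps_gt0) ?(ltW eta1_lt1).
by rewrite -natrM ler1n muln_gt0 /= muln_gt0 k0.
Qed.

(** This is where the exceptional sets enter: off [B j] no classifier is atypical
    at level [level j], so the inequality negating [atypical] holds at [lambda].
    The bound [U] comes from [x >= exp (- a)], which holds for every path. *)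
Lemma log_laplace_le_layers w' : 0 < p w' ->
  (forall n, (n < N)%N -> err f theta w' n = err f theta w n) ->
  - (N%:R * ln (x w')) - lambda * r + ln (p w') <=
  l 1%N + \sum_(1 <= j < J.+2) (w' \in B j)%:R * (l j.+1 - l j).
Proof.
move=> p0 ew; have rE : mean R N (err f theta w') = r.
  by congr (_ * _); apply: eq_bigr => i _; rewrite ew.
have N0' : 0 < N%:R :> R by rewrite ltr0n.
have HU : - (N%:R * ln (x w')) - lambda * r + ln (p w') <= U.
  have p1 : ln (p w') <= 0 by apply: ln_le0; exact: (mass_le1 finY discreteY mf).
  have : - a <= ln (x w') by rewrite -(expRK (- a)) ler_ln ?posrE ?expR_gt0.
  rewrite -(ler_pM2l N0') /a mulrN mulrC divfK ?gt_eqF// => h.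
  by rewrite /U; lra.
apply: le_layers => [//|j jJ wB|]; last by rewrite /l ltnn.
rewrite /l; case/andP: (jJ) => _ ->; rewrite le_min HU /=.
have d0 := level_gt0 jJ.
have nexc : ~ exceptional f N k pik (level j) w' theta.
  move=> exc; move/negP: wB; apply; apply/mem_set.
  exact: (total_weight_ge1 finY discreteY mf (ltW d0) exc).
have h : level j * p w' * expR (- (lambda * r)) <= x w' ^+ N.
  rewrite leNgt; apply/negP => lt; apply: nexc; exists lambda => //.
  by rewrite rE.
have E0 : 0 < expR (- (lambda * r)) := expR_gt0 _.
have dp0 : 0 < level j * p w' by rewrite mulr_gt0.
have xN0 : 0 < x w' ^+ N by rewrite exprn_gt0.
have hln : ln (level j * p w' * expR (- (lambda * r))) <= ln (x w' ^+ N).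
  by rewrite ler_ln ?posrE//; exact: mulr_gt0.
move: hln; rewrite lnM ?posrE// lnM ?posrE// expRK lnXn// -mulr_natl /L => hln.
lra.
Qed.

Let S := l 1%N + \sum_(1 <= j < J.+2) eta j * (l j.+1 - l j).

Let G (w' : Omega) : R := l 1%N + \sum_(1 <= j < J.+2) \1_(B j) w' * (l j.+1 - l j).

Let G_ge0 w' : 0 <= G w'.
Proof.
rewrite /G addr_ge0// big_seq sumr_ge0// => j; rewrite mem_index_iota => jJ.
by rewrite mulr_ge0// subr_ge0 ndl.
Qed.

Let mB j : measurable (B j).
Proof. exact: (measurable_exceptional_samples finY discreteY mf). Qed.

Let measurable_G : measurable_fun setT G.
Proof.
apply: measurable_funD => //; apply: measurable_sum => j.
by apply: measurable_funM => //; exact: measurable_indic.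
Qed.

Let integral_G_le : (\int[Q]_w' (G w')%:E <= S%:E)%E.
Proof.
rewrite /G /S big_add1 /=; under eq_integral do rewrite big_add1 /= big_mkord EFinD -sumEFin.
rewrite big_mkord EFinD -sumEFin.
have dl0 (i : 'I_J.+1) : 0 <= l i.+2 - l i.+1 by rewrite subr_ge0 ndl/=.
have mI (i : 'I_J.+1) : measurable_fun setT
    (fun w' => (\1_(B i.+1) w' * (l i.+2 - l i.+1))%:E : \bar R).
  by apply/measurable_EFinP; apply: measurable_funM => //; exact: measurable_indic.
rewrite ge0_integralD//; last 2 first.
- by move=> w' _; apply: sume_ge0 => i _; rewrite lee_fin mulr_ge0.
- exact: emeasurable_sum.
rewrite (kernel_cst P' w) leeD2l// ge0_integral_sum//; last first.
  by move=> i w' _; rewrite lee_fin mulr_ge0.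
apply: lee_sum => i _; under eq_integral do rewrite mulrC EFinM.
rewrite ge0_integralZl//; last 2 first.
- exact/measurable_EFinP/measurable_indic.
- by rewrite lee_fin.
rewrite integral_indic// setIT muleC EFinM lee_wpmul2r ?lee_fin//.
by apply: hB => /=; exact: ltn_ord.
Qed.

(** The convexity of [- ln] enters as the tangent inequality
    [ln (x / x0) <= x / x0 - 1], which is affine in [x]: its integral only needs
    the conditional mean of [x]. *)
Lemma integrated_bound :
  ((N%:R - N%:R * ln x0 - ln eps)%:E <=
     (N%:R + lambda * r + S)%:E + d' N f P' eps k pik theta w)%E.
Proof.
have N0' : 0 < N%:R :> R by rewrite ltr0n.
have x01 : x0 <= 1.
  by rewrite /x0 gerBl mulr_ge0//; [case/andP: c01 => /ltW|case/andP: m01].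
pose g w' := N%:R / x0 * x w' + (lambda * r + G w').
have lr0 : 0 <= lambda * r by rewrite mulr_ge0 ?(ltW lambda_gt0)//; case/andP: r01.
have Nx0 w' : 0 <= N%:R / x0 * x w'.
  by rewrite mulr_ge0 ?divr_ge0 ?(ltW x0_gt0) ?(ltW (x_gt0 _)).
have g0 w' : 0 <= g w' by rewrite addr_ge0// addr_ge0.
have mx : measurable_fun setT (fun w' => x w').
  by apply: measurable_funB => //; exact: measurable_funM.
have mg : measurable_fun setT g.
  by apply: measurable_funD; [exact: measurable_funM|exact: measurable_funD].
have C0 : 0 <= N%:R - N%:R * ln x0 - ln eps.
  have h1 := ln_le0 x01; have h2 := ln_le0 eps_le1.
  by rewrite subr_ge0 (le_trans h2)// subr_ge0 (@le_trans _ _ 0)// mulr_ge0_le0.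
apply: (@le_trans _ _ (\int[Q]_w' ((g w')%:E + neglog_mass w'))%E).
  rewrite -[leLHS](kernel_cst P' w); apply: ae_ge0_le_integral => //.
  - by move=> w' _; rewrite adde_ge0 ?lee_fin// neglog_mass_ge0.
  - apply: emeasurable_funD; first exact/measurable_EFinP.
    exact: measurable_neglog_mass.
  (* Both sides are compared where the path agrees with the observed sample. *)
  have := err_observed_ae finY discreteY mf hw theta.
  apply: filterS => w' ew _; rewrite neglog_massE; case: ifP => p0; last first.
    by rewrite addey// leey.
  rewrite -EFinD lee_fin.
  have := log_laplace_le_layers p0 ew.
  rewrite (eq_bigr (fun j => \1_(B j) w' * (l j.+1 - l j))) -/(G w'); last first.
    by move=> j _; rewrite indicE.
  have : ln (x w' / x0) <= x w' / x0 - 1.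
    rewrite -{1}[x w' / x0](subrK 1) addrC le_ln1Dx// ltrBrDl subrr.
    by rewrite divr_gt0.
  rewrite ln_div ?posrE// => /(ler_wpM2l (ltW N0')) h1 h2.
  rewrite /g (_ : N%:R / x0 * x w' = N%:R * (x w' / x0)); last by rewrite mulrAC mulrA.
  by lra.
rewrite ge0_integralD//; last 4 first.
- by move=> w' _; rewrite lee_fin.
- exact/measurable_EFinP.
- by move=> w' _; exact: neglog_mass_ge0.
- exact: measurable_neglog_mass.
rewrite -d'E leeD2r//.
under eq_integral do rewrite EFinD.
rewrite ge0_integralD//; last 4 first.
- by move=> w' _; rewrite lee_fin.
- by apply/measurable_EFinP; exact: measurable_funM.
- by move=> w' _; rewrite lee_fin addr_ge0.
- by apply/measurable_EFinP; exact: measurable_funD.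
under eq_integral do rewrite EFinM.
rewrite ge0_integralZl//; last 3 first.
- exact/measurable_EFinP.
- by move=> w' _; rewrite lee_fin ltW.
- by rewrite lee_fin divr_ge0// ltW.
rewrite integral_x -EFinM divfK ?gt_eqF//.
under [X in (_ + X)%E]eq_integral do rewrite EFinD.
rewrite ge0_integralD//; last 2 first.
- by move=> w' _; rewrite lee_fin.
- exact/measurable_EFinP.
by rewrite (kernel_cst P' w) -addrA !EFinD leeD2l// leeD2l.
Qed.

(** The left-over term [- eta J.+1 * ln (k * k.+1)] is nonpositive and
    dropped. *)
Lemma layer_sum_le : S <= - ln eps + ln J.+1%:R + ln (k * k.+1)%:R - ln (eta 1%N)
  + \sum_(1 <= j < J.+1) eta j * ln (eta j / eta j.+1)
  + ln (eps * eta J.+1 / J.+1%:R) * eta J.+1 + eta J.+1 * U.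
Proof.
have jJ1 : (1 <= J.+1 <= J.+1)%N by rewrite ltnSn.
(* The truncated staircase is compared with the untruncated one. *)
have lU : l J.+2 = U by rewrite /l ltnn.
have nieta j : (1 <= j <= J)%N -> eta j.+1 <= eta j by move=> jJ; exact/ltW/eta_decr.
rewrite /S (@big_nat_recr _ _ _ J.+1)//= lU addrA.
apply: le_trans (layers_monotone U (ltW eta1_lt1) nieta l_le_L) _.
have kk : 0 <= ln (k * k.+1)%:R :> R by rewrite ln_ge0// ler1n muln_gt0 k0.
have e0 := eta_gt0 jJ1.
have J0 : 0 < J.+1%:R :> R by [].
rewrite {1}/L ln_levelE// [L J.+1]/L ln_levelE//.
rewrite ln_div ?posrE ?mulr_gt0// lnM ?posrE//.
have -> : \sum_(1 <= j < J.+1) eta j * (L j.+1 - L j) =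
    \sum_(1 <= j < J.+1) eta j * ln (eta j / eta j.+1).
  apply: eq_big_nat.
  move=> j jJ; congr (_ * _); have /andP[j1 jJ'] := jJ.
  have jJ1' : (1 <= j <= J.+1)%N by rewrite j1 ltnW.
  have jJ2' : (1 <= j.+1 <= J.+1)%N by [].
  rewrite /L !ln_levelE// ln_div ?posrE ?eta_gt0//; lra.
have := mulr_ge0 (ltW e0) kk; nra.
Qed.

Lemma conditional_bound :
  (m%:E <= Phi_inv (lambda / N%:R)
     ((r + eta J.+1 * (1 - r))%:E
      + (d'' N f P' eps J.+1 eta k pik theta w + (ln (k * k.+1)%:R)%:E)
        * (lambda^-1)%:E))%E.
Proof.
have /andP[_ m1] := m01; have := integrated_bound; rewrite /d''.
have : (0 <= d' N f P' eps k pik theta w)%E.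
  by rewrite d'E; apply: integral_ge0 => w' _; exact: neglog_mass_ge0.
(* For an infinite [d'] the right-hand side is at least 1. *)
case: (d' N f P' eps k pik theta w) => [y| |]//= _ h; last first.
  by rewrite !addye// gt0_mulye ?lte_fin ?invr_gt0// addey//; exact: le_Phi_inv_pinfty.
set D := (X in (y%:E + X%:E)%E).
apply: (@le_Phi_inv _ _ _ _ (r + eta J.+1 * (1 - r) +
  (y + D + ln (k * k.+1)%:R) / lambda)) => //.
move: h; rewrite -EFinD lee_fin -/a -/c -/x0 => h.
have S_le := layer_sum_le.
rewrite mulrDr [lambda * (_ / lambda)]mulrC divfK ?gt_eqF//.
move: S_le h; rewrite /D /U; lra.
Qed.

End ConditionalBound.

(** * Union bound over the sample sizes and the levels *)

Lemma markov_lt d (T : measurableType d) (R : realType) (mu : {measure set T -> \bar R})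
    (g : T -> \bar R) (y z : R) : measurable_fun setT g -> (forall t, 0 <= g t)%E ->
  0 < y -> (\int[mu]_t g t <= z%:E)%E -> (mu [set t | y%:E < g t] <= (z / y)%:E)%E.
Proof.
move=> mg g0 y0 gz.
have mA : measurable [set t | (y%:E < g t)%E].
  by rewrite -[X in measurable X]setTI; exact: emeasurable_fun_o_infty.
rewrite mulrC EFinM lee_pdivlMl//; apply: le_trans gz.
rewrite -integral_cst//; apply: (@le_trans _ _ (\int[mu]_(t in [set t | y%:E < g t]) g t)%E).
  apply: ge0_le_integral => //.
  - by move=> t _; rewrite lee_fin ltW.
  - exact: measurable_funTS.
  - by move=> t /= /ltW.
exact: ge0_subset_integral.
Qed.

Lemma sum_inv_succ_le (R : realType) (eps : R) n : 0 <= eps ->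
  \sum_(i < n) eps / (i.+1 * i.+2)%:R <= eps.
Proof.
move=> eps0; suff -> : \sum_(i < n) eps / (i.+1 * i.+2)%:R = eps * (1 - n.+1%:R^-1).
  by rewrite ler_piMr// gerBl invr_ge0.
elim: n => [|n IH]; first by rewrite big_ord0 invr1 subrr mulr0.
rewrite big_ord_recr/= IH natrM -[n.+2%:R]natr1.
have a0 : n.+1%:R != 0 :> R by [].
have a1 : n.+1%:R + 1 != 0 :> R by rewrite natr1.
by move: (n.+1%:R : R) a0 a1 => a a0 a1; field; rewrite a1.
Qed.

(** Solves [m = (r + k * rho) / (k + 1)] for [rho]. *)
Lemma le_risk_of_mean (R : realType) (rho r : R) (k : nat) (I : \bar R) : (0 < k)%N ->
  (((r + k%:R * rho) / k.+1%:R)%:E <= I)%E ->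
  (rho%:E <= (k.+1%:R / k%:R)%:E * I - (r / k%:R)%:E)%E.
Proof.
move=> k0 mI; have k0' : 0 < k%:R :> R by rewrite ltr0n.
rewrite leeBrDr// -EFinD.
apply: le_trans (lee_wpmul2l _ mI); last by rewrite lee_fin divr_ge0.
rewrite -EFinM lee_fin le_eqVlt; apply/orP; left; apply/eqP.
by field; rewrite nat1r !pnatr_eq0 /= -lt0n k0.
Qed.

Theorem theorem2p17 (R : realType) (N : nat) (hN : (1 <= N)%N)
    (dX dY dT : measure_display)
    (X : measurableType dX) (Y : measurableType dY) (Theta : measurableType dT)
    (cgX : countably_generated X) (cgTheta : countably_generated Theta)
    (finY : finite_set [set: Y]) (discreteY : forall A : set Y, measurable A)
    (f : Theta -> X -> Y)
    (mf : measurable_fun [set: Theta * X] (fun p : Theta * X => f p.1 p.2))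
    (Pi : 'I_N -> probability (X * Y)%type R)
    (P : probability (Omega X Y) R) (hP : is_product_law Pi P)
    (P' : R.-pker (Omega X Y) ~> (Omega X Y))
    (hP' : is_regular_conditional N P P')
    (eps : R) (eps_gt0 : 0 < eps) (eps_le1 : eps <= 1)
    (J : nat) (hJ : (1 <= J)%N) (eta : nat -> R)
    (eta1_lt1 : eta 1%N < 1)
    (eta_decr : forall j, (1 <= j < J)%N -> eta j.+1 < eta j)
    (etaJ_gt0 : 0 < eta J)
    (pi_ : nat -> R.-pker (Omega X Y) ~> Theta)
    (hpi : forall k, (1 <= k)%N -> partially_exchangeable N k (pi_ k)) :
  prob_at_least P (1 - eps)
    [set w | forall theta : Theta,
      (risk N P f theta <=
       ereal_inf
         [set (k.+1%:R / k%:R)%:E *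
              ereal_inf
                [set Phi_inv (lambda / N%:R)
                       ((r1 N f theta w + eta J * (1 - r1 N f theta w))%:E
                        + (d'' N f P' eps J eta k (pi_ k) theta w
                           + (ln (k * k.+1)%:R)%:E) * (lambda^-1)%:E)
                | lambda in [set lambda : R | (0 < lambda)%R]]
              - (r1 N f theta w / k%:R)%:E
         | k in [set k : nat | (1 <= k)%N]])%E].
Proof.
case: J hJ eta_decr etaJ_gt0 => // J _ eta_decr etaJ_gt0.
have cgXY := countably_generated_prod cgX (countably_generated_finite finY discreteY).
have [M [mM PM0 hM]] := conditional_marginals_ae hN hP hP' cgXY.
pose B k j := exceptional_samples f N k (pi_ k) (level k eps J eta j).
have mB k j : measurable (B k j).
  exact: (measurable_exceptional_samples finY discreteY mf).
have mP'B k j : measurable_fun setT (fun w => P' w (B k j)).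
  exact: measurable_kernel.
pose F k j := [set w | ((eta j)%:E < P' w (B k j))%E].
have mF k j : measurable (F k j).
  by rewrite -[X in measurable X]setTI; exact: emeasurable_fun_o_infty.
have PF k j : (1 <= k)%N -> (1 <= j <= J.+1)%N ->
    (P (F k j) <= (eps / (J.+1%:R * (k * k.+1)%:R))%:E)%E.
  move=> k1 jJ; have e0 : 0 < eta j by exact: (eta_gt0 eta_decr etaJ_gt0 jJ).
  have lv0 : 0 <= level k eps J eta j.
    exact/ltW/(level_gt0 k1 eps_gt0 eta_decr etaJ_gt0 jJ).
  have -> : eps / (J.+1%:R * (k * k.+1)%:R) = level k eps J eta j / eta j.
    by rewrite /level [RHS]mulrAC mulfK ?gt_eqF.
  (* The mean of the conditional probability is the probability itself. *)
  apply: markov_lt => //.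
  have := hP'.2 setT (B k j) measurableT (mB k j); rewrite setTI => ->.
  exact: (probability_exceptional_samples_le finY discreteY mf hN (hpi k k1) hP lv0).
(* Bad samples: those where the conditional law is not the expected one, and
   those where some exceptional set is too likely. *)
pose V := M `|` \bigcup_i \big[setU/set0]_(j < J.+1) F i.+1 j.+1.
have mU i : measurable (\big[setU/set0]_(j < J.+1) F i.+1 j.+1).
  exact: bigsetU_measurable.
have mV : measurable V by apply: measurableU => //; exact: bigcupT_measurable.
have PV : (P V <= eps%:E)%E.
  have mUU := bigcupT_measurable _ mU.
  apply: le_trans (measureU2 _ mM mUU) _.
  apply: le_trans (leeD2r _ (_ : _ <= 0)%E) _; first by rewrite [leLHS]PM0.
  rewrite add0e; apply: le_trans (generalized_Boole_inequality _ mU mUU) _.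
  apply: lime_le; first by apply: is_cvg_nneseries => n _ _; exact: measure_ge0.
  apply: nearW => n.
  apply: (@le_trans _ _ (\sum_(0 <= i < n) (eps / (i.+1 * i.+2)%:R)%:E)%E).
    apply: lee_sum => i _.
    apply: le_trans (@Boole_inequality _ _ _ P (fun j => F i.+1 j.+1) J.+1 _) _ => //.
    apply: (@le_trans _ _ (\sum_(j < J.+1) (eps / (J.+1%:R * (i.+1 * i.+2)%:R))%:E)%E).
      by apply: lee_sum => j _; apply: PF => //=.
    rewrite sumEFin sumr_const card_ord lee_fin invfM -[_ *+ J.+1]mulr_natl.
    by rewrite mulrCA mulVKf.
  rewrite sumEFin lee_fin big_mkord; exact/sum_inv_succ_le/ltW.
exists (~` V); split; first exact: measurableC.
  rewrite probability_setC// EFinB leeB//.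
move=> w /= nV theta; rewrite (riskE finY discreteY mf).
have hw : conditional_marginals N P P' w.
  by apply: contrapT => nw; apply: nV; left; exact: hM.
apply: le_ereal_inf_tmp => _ [k /= k1 <-]; apply: le_risk_of_mean => //.
apply: le_ereal_inf_tmp => _ [lambda /= lambda0 <-].
apply: (conditional_bound finY discreteY mf hN k1 hw) => // j jJ.
have /andP[j1 jJ'] := jJ.
rewrite leNgt; apply/negP => lt; apply: nV; right; exists k.-1 => //.
rewrite -(bigcup_mkord J.+1 (fun i => F k.-1.+1 i.+1)); exists j.-1.
  by rewrite /= prednK.
by rewrite !prednK.
Qed.
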